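(* Let $n\ge2$ be an integer and let $p>n$. Then there exist radii $0<r_1<r_2<1$ and constants $A_1,A_2>0$, depending only on $n$ and $p$, such that, for the finite positive Borel measure $$\nu=A_1\sigma_{r_1}+A_2\sigma_{r_2},$$ the Dirichlet problem $$\mu_u=|u|^p\nu\quad\text{in }B_1,\qquad u=0\quad\text{on }\partial B_1$$ has at least three nonzero distinct radial convex solutions $u_1,u_2,u_3\in C^{0,1}(\overline{B_1})$.
   Context: $B_r=B_r(0)\subset\mathbb{R}^n$ is the open ball centered at the origin with radius $r>0$, and $\omega_n=|B_1|$ is the Lebesgue measure of the unit ball. For $0<r<1$, $$\sigma_r=\frac{\mathcal{H}^{n-1}\lfloor\partial B_r}{n\omega_n r^{n-1}}$$ is the normalized surface measure on $\partial B_r$ (a probability measure, regarded as a Borel measure on $B_1$), where $\mathcal{H}^{n-1}$ is the $(n-1)$-dimensional Hausdorff measure. For a convex function $u$ on a convex domain $\Omega\subset\mathbb{R}^n$, the subdifferential at $x\in\Omega$ is $\partial u(x)=\{q\in\mathbb{R}^n: u(y)\ge u(x)+q\cdot(y-x)\ \text{for all }y\in\Omega\}$, and the Monge--Ampère measure of $u$ is $\mu_u(E)=|\bigcup_{x\in E}\partial u(x)|$ for Borel $E\subset\Omega$. $|u|^p\nu$ denotes the measure with density $|u|^p$ with respect to $\nu$. *)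

(* Defs.v *)
From HB Require Import structures.
From mathcomp Require Import all_boot all_order all_algebra.
From mathcomp Require Import all_classical all_reals all_analysis.
Set Implicit Arguments.
Unset Strict Implicit.
Unset Printing Implicit Defensive.
Import Order.TTheory GRing.Theory Num.Theory.
Import numFieldNormedType.Exports.
Local Open Scope classical_set_scope.
Local Open Scope ring_scope.

(* R^n is ['rV[R]_n].  The norm, [ball] and diameter that the library attaches
   to matrices are those of the max norm, so the Euclidean ones are defined
   here.  Both norms give the same topology, hence the same Borel sets. *)
Section euclidean_space.
Context {R : realType} {n : nat}.
Implicit Types (x y : 'rV[R]_n) (r : R) (A : set 'rV[R]_n).

Definition dot x y : R := \sum_(i < n) x ord0 i * y ord0 i.

Definition enorm x : R := Num.sqrt (dot x x).

Definition eball r : set 'rV[R]_n := [set x | enorm x < r].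
Definition ecball r : set 'rV[R]_n := [set x | enorm x <= r].
Definition esphere r : set 'rV[R]_n := [set x | enorm x = r].

(* Meaningful for bounded sets only; [sup set0 = 0], so the empty set has
   diameter 0. *)
Definition ediam A : R :=
  sup [set d : R | exists x y, [/\ A x, A y & d = enorm (x - y)]].

Definition box (a b : 'rV[R]_n) : set 'rV[R]_n :=
  [set x | forall i, a ord0 i <= x ord0 i <= b ord0 i].

Definition box_cover A (Q : nat -> 'rV[R]_n * 'rV[R]_n) : Prop :=
  (forall k i, (Q k).1 ord0 i <= (Q k).2 ord0 i) /\
  A `<=` \bigcup_k box (Q k).1 (Q k).2.

(* n-dimensional Lebesgue measure, n >= 1, as an outer measure: it is defined
   on all sets and agrees with the completed measure on Lebesgue measurable
   sets, which matters because the union of the subdifferentials over a Borel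
   set is Lebesgue measurable but need not be Borel. *)
Definition lebesgue_n A : \bar R :=
  ereal_inf [set (\sum_(0 <= k <oo)
                    (\prod_(i < n) ((Q k).2 ord0 i - (Q k).1 ord0 i))%:E)%E
            | Q in box_cover A].

End euclidean_space.

Definition omega {R : realType} (n : nat) : R :=
  fine (lebesgue_n (eball 1 : set 'rV[R]_n)).

Section hausdorff_measure.
Context {R : realType} {n : nat}.
Implicit Types (A : set 'rV[R]_n) (m : nat) (delta : R).

Definition delta_cover delta A (F : nat -> set 'rV[R]_n) : Prop :=
  (forall k x y, F k x -> F k y -> enorm (x - y) <= delta) /\
  A `<=` \bigcup_k F k.

Definition hausdorff_delta m delta A : \bar R :=
  ereal_inf [set (\sum_(0 <= k <oo)
                    (omega m * (ediam (F k) / 2) ^+ m)%:E)%E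
            | F in delta_cover delta A].

(* m-dimensional Hausdorff measure, m >= 1, with the normalization for which
   it agrees with Lebesgue measure when m = n.  [hausdorff_delta] increases as
   delta decreases, so its limit at 0 is this supremum. *)
Definition hausdorff m A : \bar R :=
  ereal_sup [set hausdorff_delta m delta A | delta in [set delta | 0 < delta]].

Definition sigma r A : \bar R :=
  (hausdorff n.-1 (A `&` esphere r) * ((n%:R * omega n * r ^+ n.-1)^-1)%:E)%E.

End hausdorff_measure.

Definition borel (R : realType) (n : nat) :=
  g_sigma_algebraType (@open 'rV[R]_n).

Section monge_ampere.
Context {R : realType} {n : nat}.
Implicit Types (Omega E : set 'rV[R]_n) (u : 'rV[R]_n -> R).

Definition subdifferential Omega u (x : 'rV[R]_n) : set 'rV[R]_n :=
  [set q | forall y, Omega y -> u x + dot q (y - x) <= u y].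

Definition monge_ampere Omega u E : \bar R :=
  lebesgue_n (\bigcup_(x in E) subdifferential Omega u x).

Definition lipschitz_on (D : set 'rV[R]_n) u : Prop :=
  exists L : R, forall x y, D x -> D y -> `|u x - u y| <= L * enorm (x - y).

Definition radial_on (D : set 'rV[R]_n) u : Prop :=
  forall x y, D x -> D y -> enorm x = enorm y -> u x = u y.

(* Functions on the closed unit ball are represented by total functions, whose
   values outside that ball are irrelevant. *)
Definition distinct_on (D : set 'rV[R]_n) (u v : 'rV[R]_n -> R) : Prop :=
  exists2 x, D x & u x <> v x.

Definition dirichlet_solution (p : R) (nu : {measure set (borel R n) -> \bar R})
    u : Prop :=
  (forall E : set (borel R n), measurable E -> E `<=` eball 1 ->
     monge_ampere (eball 1) u E =
       (\int[nu]_(x in E) ((`|u x| `^ p)%:E))%E) /\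
  (forall x, esphere 1 x -> u x = 0).

Definition nonzero_radial_convex_solution (p : R)
    (nu : {measure set (borel R n) -> \bar R}) u : Prop :=
  [/\ lipschitz_on (ecball 1) u,
      convex_function (eball 1) u,
      radial_on (ecball 1) u,
      dirichlet_solution p nu u &
      distinct_on (ecball 1) u (fun=> 0)].

End monge_ampere.

(* Main.v *)
Require Import Defs.
From HB Require Import structures.
From mathcomp Require Import all_boot all_order all_algebra.
From mathcomp Require Import all_classical all_reals all_analysis.
From mathcomp Require Import measurable_realfun.
From mathcomp Require Import ring lra.
Set Implicit Arguments.
Unset Strict Implicit.
Unset Printing Implicit Defensive.
Import Order.TTheory GRing.Theory Num.Theory.
Import numFieldNormedType.Exports.
Local Open Scope classical_set_scope.
Local Open Scope ring_scope.

(** A radial function whose profile is continuous and piecewise affine, with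
    slopes [0 < s1 < s2] on the three intervals cut by [r1 < r2], is convex, and
    its Monge-Ampere measure is carried by the two spheres where the slope
    jumps.  Over a part [E] of the first sphere the subdifferentials fill the
    cone over [E] up to distance [s1] from the origin; over a part of the second
    sphere they fill the cone between the distances [s1] and [s2]; all other
    subdifferentials lie in a null set ([monge_ampere_radial]).  The volume of
    the cone over [E] is a positive constant times the surface measure of [E]
    ([cone_volume_hausdorff]).  So the Dirichlet problem for this function
    amounts to two equations

      [a1 * s1 ^ n = A1 * h1 ^ p]  and  [a2 * (s2 ^ n - s1 ^ n) = A2 * h2 ^ p],

    where [h1] and [h2] are the absolute values of the function on the two
    spheres and [a1], [a2] are positive constants that depend on the radii
    ([radial_solution]).

    If [r2 - r1 = 1 / 2] and [b = 2 * (1 - r2)], they determine [s2] in terms of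
    the ratio [t = s1 / s2], because [p <> n], and eliminating [s2] leaves the
    equation [(1 - t ^ n) * (b + t) ^ p = kappa * t ^ n], where [kappa] can be
    prescribed by the choice of [A1] and [A2].  The quotient of
    [(1 - t ^ n) * (b + t) ^ p] by [t ^ n] tends to infinity at 0 and vanishes
    at 1.  Since [p > n] it is as small as desired at [t = b] if [b] is small,
    while it stays bounded below at [t = 1 / 2]; hence some value [kappa] is
    taken three times ([balance_three_roots]).

    The proportionality of cone volume and surface measure is the geometric
    heart.  The coefficients [A1] and [A2] are free, so any positive constant of
    proportionality will do.  Two finite measures on the sphere for which the
    mass of a ball centred on the sphere depends on its radius only are
    proportional ([uniform_unique]): by Fubini's theorem each can be compared
    with the other at a fixed scale ([double_counting]).  Cone volume and Hausdorff measure are both of this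
    kind, because reflections preserve them and act transitively on the sphere;
    the invariance of Lebesgue measure under reflections follows from the same
    double counting ([lebesgue_involution]).  What remains is that the surface
    measure is a Borel measure ([hausdorff_borel_measure], by Caratheodory's
    criterion), that it is positive on caps ([cone_le_hausdorff]) and finite on
    the sphere ([hausdorff_sphere_lty], by a packing argument). *)

(** * Outer measures defined by covers *)

Section cover_outer_measure.
Context {R : realType} {T I : Type}.
Variables (ok : I -> Prop) (S : I -> set T) (g : I -> R).

(** The common form of [lebesgue_n] and [hausdorff_delta]: covers by admissible
    sets [S i], each with a cost [g i]. *)
Definition cover_inf (A : set T) : \bar R :=
  ereal_inf [set (\sum_(0 <= k <oo) (g (Q k))%:E)%E
            | Q in [set Q : nat -> I |
                    (forall k, ok (Q k)) /\ A `<=` \bigcup_k S (Q k)]].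

Hypothesis g_ge0 : forall i, ok i -> 0 <= g i.

Lemma cover_inf_ge0 A : (0 <= cover_inf A)%E.
Proof.
apply: le_ereal_inf_tmp => _ [Q [okQ _] <-].
by apply: nneseries_ge0 => k _ _; rewrite lee_fin g_ge0.
Qed.

Lemma le_cover_inf : {homo cover_inf : A B / A `<=` B >-> (A <= B)%E}.
Proof.
move=> A B AB; apply: ereal_inf_le_tmp => _ [Q [okQ BQ] <-].
by exists Q => //; split => //; exact: subset_trans BQ.
Qed.

(** Near-optimal covers of the sets [A n], with errors [e / 2 ^ n.+1], are
    merged into one cover of their union. *)
Lemma cover_inf_sigma_subadditive : sigma_subadditive cover_inf.
Proof.
move=> A; have [[i ioo]|] := pselect (exists i, cover_inf (A i) = +oo%E).
  rewrite (eseries_pinfty _ _ ioo) ?leey// => n _.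
  by rewrite -ltNye (lt_le_trans _ (cover_inf_ge0 _)).
rewrite -forallNE => Aoo.
suff add2e (e : {posnum R}) :
    (cover_inf (\bigcup_n A n) <= \sum_(i <oo) cover_inf (A i) + e%:num%:E)%E.
  by apply/lee_addgt0Pr => _/posnumP[].
rewrite (le_trans _ (epsilon_trick _ _ _))//; last first.
  by move=> n; exact: cover_inf_ge0.
pose P n (B : nat -> I) := ((forall k, ok (B k)) /\ A n `<=` \bigcup_k S (B k))
  /\ (\sum_(k <oo) (g (B k))%:E <= cover_inf (A n) + (e%:num / (2 ^ n.+1)%:R)%:E)%E.
have [G PG] : {G : nat -> nat -> I & forall n, P n (G n)}.
  apply: (@choice _ _ P) => n; rewrite /P /cover_inf.
  set U := (X in ereal_inf X); move infU : (ereal_inf U) => iU.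
  case: iU infU => [r Ur|Uoo|Uoo].
  - have en1 : (0 < e%:num / (2 ^ n.+1)%:R)%R by [].
    have /(lb_ereal_inf_adherent en1) : ereal_inf U \is a fin_num by rewrite Ur.
    move=> [x [B [mB AnB muBx] xU]].
    by exists B; split => //; rewrite muBx -Ur; exact/ltW.
  - by have := Aoo n; rewrite /cover_inf Uoo.
  - by have := cover_inf_ge0 (A n); rewrite /cover_inf Uoo.
have gG i j : (0 <= (g (G i j))%:E)%E by rewrite lee_fin g_ge0//; apply: (PG i).1.1.
pose h (x : nat * nat) := (g (G x.1 x.2))%:E.
have h0 x : (0 <= h x)%E by exact: gG.
apply: (@le_trans _ _ (\esum_(i in setT) h i)%E).
  apply: ereal_inf_lbound => /=.
  have /card_esym/ppcard_eqP[f] := card_nat2.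
  exists (fun k => G (f k).1 (f k).2).
    split => [k|t [i _]]; first exact: (PG _).1.1.
    move=> /((PG i).1.2) -[j _ Bijt].
    by exists (f^-1%FUN (i, j)) => //=; rewrite invK ?inE.
  rewrite -(esum_pred_image h _ xpredT) ?[fun=> _]set_true//.
  by rewrite image_eq.
rewrite (_ : esum _ _ = \sum_(i <oo) \sum_(j <oo) h (i, j))%E; last first.
  pose J : nat -> set (nat * nat) := fun i => [set (i, j) | j in setT].
  rewrite (_ : setT = \bigcup_k J k); last first.
    by rewrite predeqE => -[a b]; split => // _; exists a => //; exists b.
  rewrite esum_bigcupT//=; last first.
    apply/trivIsetP => i j _ _ ij.
    rewrite predeqE => -[n m] /=; split => //= -[] [_] _ [<-{n} _].
    by move=> [m' _] [] /esym/eqP; rewrite (negbTE ij).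
  rewrite -(image_id [set: nat]) -fun_true esum_pred_image//; last first.
    by move=> n _; exact: esum_ge0.
  apply: eq_eseriesr => /= j _.
  rewrite -(esum_pred_image h (pair j) predT)//=; last first.
    by move=> ? ? _ _; exact: (@can_inj _ _ _ snd).
  by congr esum; rewrite predeqE => -[a b]; split; move=> [i _ <-]; exists i.
apply: lee_nneseries => n _; first by move=> ?; apply: nneseries_ge0 => *; exact: h0.
exact: (PG n).2.
Qed.

Lemma cover_outer_measure i0 : ok i0 -> g i0 = 0 ->
  exists mu : {outer_measure set T -> \bar R}, mu = cover_inf :> (set T -> \bar R).
Proof.
move=> ok0 g0.
have c0 : cover_inf set0 = 0%E.
  apply/eqP; rewrite eq_le cover_inf_ge0 andbT; apply: ereal_inf_lbound.
  exists (fun=> i0); first by split.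
  by rewrite eseries0// => k _ _; rewrite g0.
pose M := isOuterMeasure.Build R T cover_inf c0 cover_inf_ge0 le_cover_inf
  cover_inf_sigma_subadditive.
pose mu : {outer_measure set T -> \bar R} := HB.pack cover_inf M.
by exists mu.
Qed.

End cover_outer_measure.

(** * Euclidean geometry and Borel sets *)

Lemma exists_invS_lt {R : realType} (e : R) : 0 < e ->
  exists k : nat, k.+1%:R^-1 < e.
Proof.
move=> e0; exists (Num.truncn e^-1).
by rewrite invf_plt ?posrE// truncnS_gt.
Qed.

Section euclidean_lemmas.
Context {R : realType} {n : nat}.
Implicit Types (x y z : 'rV[R]_n) (a b e r : R).

Lemma dotC x y : dot x y = dot y x.
Proof. by apply: eq_bigr => i _; rewrite mulrC. Qed.

Lemma dotDl x y z : dot (x + y) z = dot x z + dot y z.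
Proof. by rewrite -big_split; apply: eq_bigr => i _; rewrite !mxE mulrDl. Qed.

Lemma dotZl a x y : dot (a *: x) y = a * dot x y.
Proof. by rewrite mulr_sumr; apply: eq_bigr => i _; rewrite !mxE mulrA. Qed.

Lemma dotDr x y z : dot x (y + z) = dot x y + dot x z.
Proof. by rewrite !(dotC x) dotDl. Qed.

Lemma dotZr a x y : dot x (a *: y) = a * dot x y.
Proof. by rewrite !(dotC x) dotZl. Qed.

Lemma dotNl x y : dot (- x) y = - dot x y.
Proof. by rewrite -scaleN1r dotZl mulN1r. Qed.

Lemma dotNr x y : dot x (- y) = - dot x y.
Proof. by rewrite !(dotC x) dotNl. Qed.

Definition dotE := (dotDl, dotDr, dotNl, dotNr, dotZl, dotZr).

Lemma dot_ge0 x : 0 <= dot x x.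
Proof. by apply: sumr_ge0 => i _; rewrite -expr2 sqr_ge0. Qed.

Lemma enorm_ge0 x : 0 <= enorm x. Proof. exact: sqrtr_ge0. Qed.

Lemma enorm_sqr x : enorm x ^+ 2 = dot x x.
Proof. by rewrite sqr_sqrtr// dot_ge0. Qed.

Lemma coord_le_enorm x i : `|x ord0 i| <= enorm x.
Proof.
rewrite -sqrtr_sqr ler_wsqrtr// /dot (bigD1 i)//= -expr2 lerDl.
by apply: sumr_ge0 => j _; rewrite -expr2 sqr_ge0.
Qed.

Lemma enorm_eq0 x : (enorm x == 0) = (x == 0).
Proof.
apply/eqP/eqP => [x0|->].
  apply/rowP => i; rewrite mxE; apply/eqP; rewrite -normr_le0 -x0.
  exact: coord_le_enorm.
by rewrite /enorm /dot big1 ?sqrtr0// => i _; rewrite mxE mul0r.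
Qed.

Lemma enorm0 : enorm (0 : 'rV[R]_n) = 0.
Proof. by apply/eqP; rewrite enorm_eq0. Qed.

Lemma enorm_gt0 x : (0 < enorm x) = (x != 0).
Proof. by rewrite lt_neqAle eq_sym enorm_eq0 enorm_ge0 andbT. Qed.

Lemma enormZ a x : enorm (a *: x) = `|a| * enorm x.
Proof.
by rewrite /enorm dotZl dotZr mulrA -expr2 sqrtrM ?sqr_ge0// sqrtr_sqr.
Qed.

Lemma enormN x : enorm (- x) = enorm x.
Proof. by rewrite /enorm dotNl dotNr opprK. Qed.

Lemma enormC x y : enorm (x - y) = enorm (y - x).
Proof. by rewrite -enormN opprB. Qed.

Lemma cauchy_schwarz x y : dot x y <= enorm x * enorm y.
Proof.
have [->|x0] := eqVneq x 0.
  by rewrite enorm0 mul0r /dot big1// => i _; rewrite mxE mul0r.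
have [->|y0] := eqVneq y 0.
  by rewrite enorm0 mulr0 /dot big1// => i _; rewrite mxE mulr0.
move: x0 y0; rewrite -!enorm_gt0 => x0 y0.
have := dot_ge0 (enorm y *: x - enorm x *: y).
rewrite !dotE (dotC y x) -!enorm_sqr.
have xy0 : 0 < enorm x * enorm y by rewrite mulr_gt0.
move=> h; rewrite -(ler_pM2l xy0).
by move: (enorm x) (enorm y) (dot x y) h => a b d h; lra.
Qed.

(** The square of the norm of [enorm y *: x - enorm x *: y] is
    [2 * enorm x * enorm y * (enorm x * enorm y - dot x y)]. *)
Lemma cauchy_schwarz_eq x y : enorm x * enorm y <= dot x y ->
  enorm y *: x = enorm x *: y.
Proof.
move=> xy; apply/eqP; rewrite -subr_eq0 -enorm_eq0 -sqrf_eq0 enorm_sqr.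
rewrite eq_le dot_ge0 andbT !dotE (dotC y x) -!enorm_sqr.
have := mulr_ge0 (enorm_ge0 x) (enorm_ge0 y); nra.
Qed.

Lemma ler_enormD x y : enorm (x + y) <= enorm x + enorm y.
Proof.
have h := cauchy_schwarz x y.
rewrite -(ler_pXn2r (n := 2))// ?nnegrE ?addr_ge0 ?enorm_ge0//.
rewrite enorm_sqr !dotE (dotC y x) -!enorm_sqr; nra.
Qed.

Lemma ler_enormB x y z : enorm (x - z) <= enorm (x - y) + enorm (y - z).
Proof. by rewrite (le_trans _ (ler_enormD _ _))// addrA subrK. Qed.

Lemma enorm_le_coord x e : 0 <= e -> (forall i, `|x ord0 i| <= e) ->
  enorm x <= n.+1%:R * e.
Proof.
move=> e0 xe; rewrite -(ger0_norm (_ : 0 <= n.+1%:R * e)) ?mulr_ge0//.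
rewrite -sqrtr_sqr ler_wsqrtr// (@le_trans _ _ (\sum_(i < n) e ^+ 2))//.
  by apply: ler_sum => i _; rewrite -expr2 -real_normK ?num_real// lerXn2r ?nnegrE.
rewrite sumr_const card_ord -[leLHS]mulr_natl exprMn ler_wpM2r ?sqr_ge0//.
by rewrite -natrX ler_nat expnS (leq_trans (leqnSn n))// leq_pmulr// expn_gt0.
Qed.

(** The library's topology on row vectors is that of the max norm, which is
    equivalent to the Euclidean norm. *)
Lemma open_enormP (U : set 'rV[R]_n) :
  open U <-> forall x, U x -> exists2 e, 0 < e & forall y, enorm (x - y) < e -> U y.
Proof.
rewrite openE; split=> [oU x /oU /nbhs_ballP[e /= e0 xeU]|oU x /oU[e e0 xeU]].
  exists e => // y xy; apply: xeU; split => // i j.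
  rewrite !ord1 /ball /= (le_lt_trans _ xy)//.
  by have := coord_le_enorm (x - y) j; rewrite !mxE.
apply/nbhs_ballP; exists (e / 2 / n.+1%:R) => /=; first by rewrite !divr_gt0.
move=> y [_ xy]; apply: xeU.
apply: (@le_lt_trans _ _ (e / 2)); last by rewrite gtr_pMr// invf_lt1// ltr1n.
rewrite (_ : e / 2 = n.+1%:R * (e / 2 / n.+1%:R)); last first.
  by rewrite mulrCA divff ?mulr1// pnatr_eq0.
apply: enorm_le_coord => [|i]; first by rewrite !divr_ge0// ltW.
by rewrite !mxE ltW//; exact: xy.
Qed.

Definition cball x r : set 'rV[R]_n := [set y | enorm (x - y) < r].

Lemma open_cball x r : open (cball x r).
Proof.
apply/open_enormP => y xy; exists (r - enorm (x - y)); rewrite ?subr_gt0//.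
move=> z yz; apply: le_lt_trans (ler_enormB x y z) _.
by rewrite -ltrBrDl.
Qed.

Lemma eball_cball r : eball r = cball 0 r.
Proof. by apply/seteqP; split=> x; rewrite /eball /cball /= sub0r enormN. Qed.

End euclidean_lemmas.

Section borel_sets.
Context {R : realType} {n : nat}.
Local Notation B := (borel R n).

(** Half-spaces generate the Borel sets, as every open set is a countable
    union of half-open cubes with rational centres. *)
Lemma open_preimage_measurable d (T : measurableType d) (f : T -> 'rV[R]_n) :
  (forall i a, measurable (f @^-1` [set x | x ord0 i <= a])) ->
  forall U, open U -> measurable (f @^-1` U).
Proof.
move=> mf U oU.
pose Q (c : 'rV[rat]_n * nat) : set 'rV[R]_n :=
  [set x | forall i, ratr (c.1 ord0 i) - c.2.+1%:R^-1 < x ord0 i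
                     <= ratr (c.1 ord0 i) + c.2.+1%:R^-1].
have mQ c : measurable (f @^-1` Q c).
  rewrite (_ : _ @^-1` _ = \bigcap_(i in setT)
    (f @^-1` [set x | x ord0 i <= ratr (c.1 ord0 i) + c.2.+1%:R^-1] `\`
     f @^-1` [set x | x ord0 i <= ratr (c.1 ord0 i) - c.2.+1%:R^-1])).
    by apply: fin_bigcap_measurable => // i _; apply: measurableD.
  apply/seteqP; split=> [t /= Qt i _|t /= Qt i].
    by have /andP[h1 h2] := Qt i; split => //; apply/negP; rewrite -ltNge.
  by have [h1 /negP] := Qt i I; rewrite -ltNge => h2; rewrite h2.
rewrite (_ : U = \bigcup_c (if `[< Q c `<=` U >] then Q c else set0)).
  rewrite preimage_bigcup.
  apply: countable_bigcupT_measurable => // c.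
  by case: ifP => // _; rewrite preimage_set0.
apply/seteqP; split=> [x Ux|x [c _]]; last by case: asboolP => // cU /cU.
have [e e0 xeU] := (open_enormP U).1 oU x Ux.
have [k ke] : exists k : nat, n.+1%:R * (2 * k.+1%:R^-1) < e :> R.
  have [|k ke] := @exists_invS_lt _ (e / (n.+1%:R * 2)).
    by rewrite divr_gt0// mulr_gt0.
  by exists k; rewrite mulrA mulrC -ltr_pdivlMr// mulr_gt0.
have k0 : 0 < k.+1%:R^-1 :> R by rewrite invr_gt0.
have : forall i, {q : rat | ratr q - k.+1%:R^-1 < x ord0 i <= ratr q + k.+1%:R^-1}.
  move=> i; apply: cid.
  have /rat_in_itvoo[q] : x ord0 i - k.+1%:R^-1 < x ord0 i by rewrite ltrBlDl ltrDr.
  rewrite in_itv/= => /andP[q1 q2]; exists q.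
  by rewrite -lerBlDr (ltW q1) andbT ltrBlDr (lt_trans q2)// ltrDl.
move=> q; exists (\row_i sval (q i), k) => //.
case: asboolP => [_ i|]; first by rewrite mxE; exact: svalP (q i).
case=> y Qy; apply: xeU; apply: le_lt_trans ke.
apply: enorm_le_coord; first by rewrite mulr_ge0// ltW.
move=> i; have /andP[] := Qy i; have /andP[] := svalP (q i).
rewrite !mxE /=.
have aux (c r u v : R) : c - r < u -> u <= c + r -> c - r < v -> v <= c + r ->
    `|u - v| <= 2 * r.
  by move=> h1 h2 h3 h4; rewrite ler_norml; apply/andP; split; lra.
exact: aux.
Qed.

Lemma borel_preimage_measurable d (T : measurableType d) (f : T -> 'rV[R]_n) :
  (forall i a, measurable (f @^-1` [set x | x ord0 i <= a])) ->
  forall E : set B, measurable E -> measurable (f @^-1` E).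
Proof.
move=> /open_preimage_measurable mf.
suff H : (measurable : set (set B)) `<=` [set A | measurable (f @^-1` A)] by exact: H.
apply: smallest_sub => //; split => /=.
- by rewrite preimage_set0.
- by move=> A mA; rewrite setTD preimage_setC; exact: measurableC.
- by move=> F mF; rewrite preimage_bigcup; exact: bigcupT_measurable.
Qed.

Lemma open_borel (U : set B) : open (U : set 'rV[R]_n) -> measurable U.
Proof. exact: sub_sigma_algebra. Qed.

Lemma measurable_coord i : measurable_fun setT (fun x : B => x ord0 i).
Proof.
apply: (measurability _ (RGenOpens.measurableE R)) => _ [_ [a [b ->] <-]].
rewrite setTI; apply: open_borel.
have /continuousP := @coord_continuous R 1 n ord0 i.
by apply; exact: interval_open.
Qed.

Lemma measurable_borel d (T : measurableType d) (f : T -> B) :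
  (forall i, measurable_fun setT (fun t => f t ord0 i)) -> measurable_fun setT f.
Proof.
move=> mf _ E mE; rewrite setTI; apply: borel_preimage_measurable => // i a.
rewrite -[X in measurable X]setTI.
rewrite (_ : f @^-1` _ = (fun t => f t ord0 i) @^-1` `]-oo, a]%classic).
  by apply: mf => //; exact: measurable_itv.
by apply/seteqP; split=> t /=; rewrite in_itv.
Qed.

Lemma measurable_enorm : measurable_fun setT (fun x : B => enorm x).
Proof.
rewrite (_ : (fun _ => _) = (fun x : B => (dot x x) `^ (2^-1))).
  apply: (measurableT_comp (measurable_powR _)).
  apply: measurable_sum => i; apply: measurable_funM; exact: measurable_coord.
by apply/funext => x; rewrite powR12_sqrt// dot_ge0.
Qed.

End borel_sets.

(** * Lebesgue measure *)

Section borel_restriction.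
Context {R : realType} {n : nat}.

(** Caratheodory's theorem makes an outer measure additive on the sigma-algebra
    of its measurable sets, which contains the Borel sets as soon as it contains
    the half-spaces. *)
Lemma caratheodory_borel_measure (mu : {outer_measure set 'rV[R]_n -> \bar R}) :
  (forall i a, mu.-caratheodory [set x | x ord0 i <= a]) ->
  exists m : {measure set (borel R n) -> \bar R},
    forall E : set 'rV[R]_n, m E = mu E.
Proof.
move=> mhalf.
have mb : forall E : set (borel R n), measurable E -> mu.-caratheodory E.
  exact: (@borel_preimage_measurable R n _ (caratheodory_type mu) id mhalf).
have sa : semi_sigma_additive (mu : set (borel R n) -> \bar R).
  move=> F mF tF mUF; apply: (@caratheodory_measure_sigma_additive _ _ mu) => //.
    by move=> i; apply: mb; exact: mF.
  exact: mb.
pose M := isMeasure.Build _ (borel R n) R (mu : set (borel R n) -> \bar R)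
  (outer_measure0 mu) (outer_measure_ge0 mu) sa.
pose m : {measure set (borel R n) -> \bar R} := HB.pack (mu : set (borel R n) -> \bar R) M.
by exists m.
Qed.

End borel_restriction.

Section lebesgue_outer.
Context {R : realType} {n : nat}.
Implicit Types (A : set 'rV[R]_n) (q : 'rV[R]_n * 'rV[R]_n).

Let ok q := forall i, q.1 ord0 i <= q.2 ord0 i.
Let vol q : R := \prod_(i < n) (q.2 ord0 i - q.1 ord0 i).

Let lebesgueE : @lebesgue_n R n = cover_inf ok (fun q => box q.1 q.2) vol.
Proof. by []. Qed.

Let vol_ge0 q : ok q -> 0 <= vol q.
Proof. by move=> okq; apply: prodr_ge0 => i _; rewrite subr_ge0. Qed.

Lemma lebesgue_n_ge0 A : (0 <= lebesgue_n A)%E.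
Proof. by rewrite lebesgueE; exact: cover_inf_ge0. Qed.

Lemma le_lebesgue_n A A' : A `<=` A' -> (lebesgue_n A <= lebesgue_n A')%E.
Proof. by rewrite lebesgueE; exact: le_cover_inf. Qed.

Lemma lebesgue_outer_measure : (0 < n)%N ->
  exists mu : {outer_measure set 'rV[R]_n -> \bar R},
    mu = @lebesgue_n R n :> (set 'rV[R]_n -> \bar R).
Proof.
move=> n0; rewrite lebesgueE.
apply: (@cover_outer_measure R _ _ ok (fun q => box q.1 q.2) vol vol_ge0 (0, 0)).
  by move=> j; rewrite lexx.
by rewrite /vol (bigD1 (Ordinal n0))//= !mxE subrr mul0r.
Qed.

Section half_space.
Variables (i : 'I_n) (c : R).

(* The position of the cut is clamped to the box, so that a box on one side
   of the hyperplane is cut into itself and a degenerate box. *)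
Let cut q : R := Num.max (q.1 ord0 i) (Num.min (q.2 ord0 i) c).
Let lower q := (q.1, \row_j (if j == i then cut q else q.2 ord0 j)).
Let upper q := (\row_j (if j == i then cut q else q.1 ord0 j), q.2).

Let cut_itv q : ok q -> q.1 ord0 i <= cut q <= q.2 ord0 i.
Proof.
move=> okq; rewrite /cut le_max lexx/= ge_max okq/=.
by rewrite ge_min lexx.
Qed.

Let ok_lower q : ok q -> ok (lower q).
Proof.
move=> okq j; rewrite /= mxE; case: eqP => [->|_]; last exact: okq.
by have /andP[] := cut_itv okq.
Qed.

Let ok_upper q : ok q -> ok (upper q).
Proof.
move=> okq j; rewrite /= mxE; case: eqP => [->|_]; last exact: okq.
by have /andP[] := cut_itv okq.
Qed.

Let vol_cut q : vol (lower q) + vol (upper q) = vol q.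
Proof.
rewrite /vol (bigD1 i)//= [X in _ + X](bigD1 i)//= [RHS](bigD1 i)//= !mxE eqxx.
rewrite (eq_bigr (fun j => q.2 ord0 j - q.1 ord0 j)); last first.
  by move=> j /negPf ji; rewrite mxE ji.
rewrite [X in _ + _ * X](eq_bigr (fun j => q.2 ord0 j - q.1 ord0 j)); last first.
  by move=> j /negPf ji; rewrite mxE ji.
by ring.
Qed.

(** The hyperplane cuts every box of a cover into two boxes whose volumes add
    up to the volume of the box. *)
Lemma half_space_caratheodory :
  (@lebesgue_n R n).-caratheodory [set x | x ord0 i <= c].
Proof.
have [mu muE] := lebesgue_outer_measure (leq_ltn_trans (leq0n i) (ltn_ord i)).
rewrite -muE; apply: le_caratheodory_measurable => X; rewrite muE.
apply: le_ereal_inf_tmp => _ [Q [okQ XQ] <-].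
under eq_eseriesr => k _ do rewrite -/(vol (Q k)) -vol_cut EFinD.
rewrite nneseriesD; last 2 first.
- by move=> k _ _; rewrite lee_fin; apply: vol_ge0; exact: ok_lower.
- by move=> k _ _; rewrite lee_fin; apply: vol_ge0; exact: ok_upper.
apply: leeD; apply: ereal_inf_lbound.
- exists (lower \o Q) => //; split => [k|x [/XQ[k _ Qk] xc]]; first exact: ok_lower.
  exists k => // j /=; rewrite mxE; case: eqP => [->|_]; last exact: Qk.
  have /andP[-> h] := Qk i; rewrite /= /cut le_max le_min h.
  by move: xc => /= ->; rewrite orbT.
- exists (upper \o Q) => //; split => [k|x [/XQ[k _ Qk] /negP]]; first exact: ok_upper.
  rewrite -ltNge => xc.
  exists k => // j /=; rewrite mxE; case: eqP => [->|_]; last exact: Qk.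
  have /andP[h ->] := Qk i; rewrite /= /cut ge_max h ge_min (ltW xc).
  by rewrite orbT.
Qed.

End half_space.

Lemma lebesgue_borel_measure : (0 < n)%N ->
  exists m : {measure set (borel R n) -> \bar R},
    forall E : set 'rV[R]_n, m E = lebesgue_n E.
Proof.
move=> n0; have [mu muE] := lebesgue_outer_measure n0.
rewrite -muE; apply: caratheodory_borel_measure => i a.
by rewrite muE; exact: half_space_caratheodory.
Qed.

Lemma lebesgue_box_le (a b : 'rV[R]_n) : (0 < n)%N ->
  (forall i, a ord0 i <= b ord0 i) ->
  (lebesgue_n (box a b) <= (\prod_(i < n) (b ord0 i - a ord0 i))%:E)%E.
Proof.
move=> n0 ab; apply: ereal_inf_lbound.
pose Q k := if k == 0%N then (a, b) else (0, 0).
have okQ k : ok (Q k) by rewrite /Q; case: ifP => // _ i.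
exists Q; first by split=> // x abx; exists 0%N.
rewrite nneseries_recl//; last by move=> k _; rewrite lee_fin vol_ge0.
rewrite eseries_cond eseries0 ?adde0// => -[//|k] _ _ /=.
by rewrite (bigD1 (Ordinal n0))//= !mxE subrr mul0r.
Qed.

Definition affine (t : R) (c x : 'rV[R]_n) : 'rV[R]_n := t *: x + c.

Let lebesgue_affine_le (t : R) (c : 'rV[R]_n) A : 0 < t ->
  ((t ^+ n)%:E * lebesgue_n (affine t c @^-1` A) <= lebesgue_n A)%E.
Proof.
move=> t0; apply: le_ereal_inf_tmp => _ [Q [okQ AQ] <-].
pose Q' k := (t^-1 *: ((Q k).1 - c), t^-1 *: ((Q k).2 - c)).
have volE k : vol (Q k) = t ^+ n * vol (Q' k).
  rewrite /vol -[X in t ^+ X]card_ord -prodr_const -big_split/=; apply: eq_bigr => i _.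
  by rewrite !mxE -mulrBr mulrA divff ?gt_eqF// mul1r opprB addrA subrK.
have okQ' k : ok (Q' k).
  by move=> i; rewrite !mxE ler_pM2l ?invr_gt0// lerD2r; exact: okQ.
under eq_eseriesr => k _ do rewrite -/(vol (Q k)) volE EFinM.
rewrite nneseriesZl; last by move=> k _; rewrite lee_fin vol_ge0.
apply: lee_wpmul2l; first by rewrite lee_fin exprn_ge0// ltW.
apply: ereal_inf_lbound; exists Q' => //; split => // x /= /AQ[k _ Qk].
exists k => // i; have := Qk i; rewrite !mxE => /andP[h1 h2].
by rewrite ler_pdivrMl// lerBlDr h1 ler_pdivlMl// lerBrDr.
Qed.

Lemma lebesgue_affine (t : R) (c : 'rV[R]_n) A : 0 < t ->
  lebesgue_n A = ((t ^+ n)%:E * lebesgue_n (affine t c @^-1` A))%E.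
Proof.
move=> t0; apply/eqP; rewrite eq_le lebesgue_affine_le// andbT.
have tn0 : 0 < t ^+ n by rewrite exprn_gt0.
rewrite -lee_pdivrMl// -exprVn.
have := @lebesgue_affine_le (t^-1) (- (t^-1 *: c)) (affine t c @^-1` A).
rewrite invr_gt0 => /(_ t0); rewrite (_ : _ @^-1` _ = A)//.
by apply/seteqP; split=> x /=;
  rewrite /affine scalerBr !scalerA divff ?gt_eqF// !scale1r subrK.
Qed.

End lebesgue_outer.

(** Lower bound for the cost of a cover of the unit cube, by induction on the
    dimension: each slice of the cube is covered by slices of the boxes, and the
    bound for the slices is integrated over the remaining coordinate.  The
    weights make the statement inductive: a box that misses a slice gets weight
    0 there. *)
Lemma cube_weighted_cover {R : realType} n (Q : nat -> 'rV[R]_n * 'rV[R]_n)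
    (w : nat -> R) :
  (forall k i, (Q k).1 ord0 i <= (Q k).2 ord0 i) -> (forall k, 0 <= w k) ->
  (forall x : 'rV[R]_n, (forall i, 0 <= x ord0 i <= 1) ->
     (1 <= \sum_(0 <= k <oo) (w k * \1_(box (Q k).1 (Q k).2) x)%:E)%E) ->
  (1 <= \sum_(0 <= k <oo)
     (w k * \prod_(i < n) ((Q k).2 ord0 i - (Q k).1 ord0 i))%:E)%E.
Proof.
elim: n => [|n IH] in Q w *.
  move=> _ w0 /(_ 0) h; apply: le_trans (h _) _; first by case.
  apply: lee_nneseries => k _.
    by move=> _; rewrite lee_fin mulr_ge0// indicE.
  by rewrite big_ord0 lee_fin ler_wpM2l// indicE; case: (_ \in _).
move=> okQ w0 cov.
pose I k : set R := `[(Q k).1 ord0 ord0, (Q k).2 ord0 ord0]%classic.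
pose tl (x : 'rV[R]_n.+1) : 'rV[R]_n := \row_i x ord0 (lift ord0 i).
pose Q' k := (tl (Q k).1, tl (Q k).2).
pose v k : R := \prod_(i < n) ((Q' k).2 ord0 i - (Q' k).1 ord0 i).
have v0 k : 0 <= v k by apply: prodr_ge0 => i _; rewrite !mxE subr_ge0.
have slice t : 0 <= t <= 1 ->
    (1 <= \sum_(0 <= k <oo) (w k * v k * \1_(I k) t)%:E)%E.
  move=> t01.
  have := IH Q' (fun k => w k * \1_(I k) t).
  rewrite (eq_eseriesr (g := fun k => (w k * v k * \1_(I k) t)%:E)); last first.
    by move=> k _; rewrite mulrAC.
  apply.
  - by move=> k i; rewrite !mxE.
  - by move=> k; rewrite mulr_ge0// indicE.
  move=> y y01; pose x : 'rV[R]_n.+1 := \row_i oapp (fun j => y ord0 j) t (unlift ord0 i).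
  apply: le_trans (cov x _) _.
    by move=> i; rewrite mxE; case: unliftP => [j _|_] //=.
  apply: lee_nneseries => k _; first by move=> _; rewrite lee_fin mulr_ge0// indicE.
  rewrite lee_fin -mulrA ler_wpM2l// !indicE; case: (boolP (x \in _)); last by rewrite mulr_ge0.
  rewrite inE => xQ; rewrite !mem_set ?mulr1//.
    by move=> i; have := xQ (lift ord0 i); rewrite !mxE liftK.
  by have := xQ ord0; rewrite mxE unlift_none /I /= in_itv.
pose mu : {measure set (measurableTypeR R) -> \bar R} := @lebesgue_measure R.
have mI k : measurable (I k) by exact: measurable_itv.
have m01 : measurable (`[0, 1]%classic : set R) by exact: measurable_itv.
have mIf k D : measurable_fun D (\1_(I k) : measurableTypeR R -> R).
  exact: (@measurable_indic _ (measurableTypeR R) R D (I k) (mI k)).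
have : (\int[mu]_(t in `[0%R, 1%R]) (cst 1 t) <=
        \int[mu]_(t in `[0%R, 1%R]) \sum_(0 <= k <oo) (w k * v k * \1_(I k) t)%:E)%E.
  apply: ge0_le_integral => //.
  apply: (@ge0_emeasurable_sum _ _ _ _ _ xpredT) => [k t _ _|k _].
    by rewrite lee_fin !mulr_ge0// indicE.
  by apply/measurable_EFinP; apply: measurable_funM => //; exact: mIf.
have mu01 : mu `[0%R, 1%R]%classic = 1%E.
  by rewrite /= lebesgue_measure_itv/= lte_fin ltr01 sube0.
rewrite integral_cst// mu01 mul1e.
move/le_trans; apply.
rewrite integral_nneseries//; last 2 first.
- by move=> k; apply/measurable_EFinP; apply: measurable_funM => //; exact: mIf.
- by move=> k t _; rewrite lee_fin !mulr_ge0// indicE.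
apply: lee_nneseries => k _.
  by move=> _; apply: integral_ge0 => t _; rewrite lee_fin !mulr_ge0// indicE.
under eq_integral do rewrite EFinM.
rewrite ge0_integralZl_EFin//; last 2 first.
- by apply/measurable_EFinP; exact: mIf.
- by rewrite mulr_ge0.
rewrite [X in (_ * X <= _)%E](_ : _ = mu (I k `&` `[0%R, 1%R]%classic)); last first.
  by apply: integral_indic => //; exact: mI.
rewrite big_ord_recl mulrCA [leRHS]EFinM muleC.
rewrite [X in (_ <= _ * (X)%:E)%E](_ : _ = w k * v k); last first.
  by congr (_ * _); apply: eq_bigr => i _; rewrite !mxE.
apply: lee_wpmul2r; first by rewrite lee_fin mulr_ge0.
apply: (@le_trans _ _ (mu (I k))).
  apply: le_measure => [||x []//]; rewrite inE; last exact: mI.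
  by apply: measurableI; [exact: mI|exact: m01].
rewrite /= lebesgue_measure_itv/= lte_fin.
by case: ifPn => // _; rewrite lee_fin subr_ge0.
Qed.

Lemma exprB_le {R : realType} (x y : R) n : 0 <= y -> y <= x ->
  x ^+ n - y ^+ n <= (x - y) * (n%:R * x ^+ n.-1).
Proof.
move=> y0 yx; have x0 := le_trans y0 yx.
rewrite subrXX ler_wpM2l ?subr_ge0// mulr_natl.
have -> : x ^+ n.-1 *+ n = \sum_(i < n) x ^+ n.-1 by rewrite sumr_const card_ord.
apply: ler_sum => i _; rewrite [leRHS](_ : _ = x ^+ (n.-1 - i) * x ^+ i).
  by rewrite ler_wpM2l ?exprn_ge0// lerXn2r ?nnegrE.
by rewrite -exprD subnK// -ltnS prednK// (leq_ltn_trans _ (ltn_ord i)).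
Qed.

(** Used for sets that are covered, at every scale [e], at a cost of order
    [e]. *)
Lemma le_small_eq0 {R : realType} (x : \bar R) (C : R) : (0 <= x)%E ->
  (forall e : R, 0 < e -> e <= 1 -> (x <= (e * C)%:E)%E) -> x = 0%E.
Proof.
move=> x0 xC; apply/eqP; rewrite eq_le x0 andbT.
apply/lee_addgt0Pr => e e0; rewrite add0e.
have C0 : 0 < `|C| + 1 by rewrite ltr_wpDl.
have := xC (Num.min 1 (e / (`|C| + 1))).
rewrite lt_min ltr01 divr_gt0// ge_min lexx => /(_ isT isT) /le_trans; apply.
rewrite lee_fin (@le_trans _ _ (Num.min 1 (e / (`|C| + 1)) * (`|C| + 1)))//.
  rewrite ler_wpM2l//; first by rewrite le_min ler01 divr_ge0 ?ltW.
  by rewrite (le_trans (ler_norm _))// lerDl.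
by rewrite -ler_pdivlMr// ge_min lexx orbT.
Qed.

Section ball_volume.
Context {R : realType}.

Lemma unit_cube_ge1 n : (1 <= @lebesgue_n R n (box 0%R (const_mx 1%R)))%E.
Proof.
apply: le_ereal_inf_tmp => _ [Q [okQ cov] <-].
have := @cube_weighted_cover R n Q (fun=> 1) okQ (fun=> ler01).
under eq_eseriesr do rewrite mul1r.
apply => x x01.
have [|k _ Qk] := cov x; first by move=> i; rewrite !mxE.
rewrite (nneseriesD1 (n := k))//.
rewrite mul1r indicE mem_set// leeDl// nneseries_ge0// => j _ _.
Qed.

(** The unit cube shrunk by the factor [n.+2] lies in the unit ball. *)
Lemma unit_ball_gt0 n : (0 < @lebesgue_n R n (eball 1))%E.
Proof.
have n2 : 0 < n.+2%:R :> R by [].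
have := @lebesgue_affine R n n.+2%:R^-1 0 (eball 1); rewrite invr_gt0 => /(_ n2) ->.
rewrite mule_gt0 ?lte_fin ?exprn_gt0 ?invr_gt0//.
apply: (@lt_le_trans _ _ 1%E) => //; apply: le_trans (unit_cube_ge1 n) _.
apply: le_lebesgue_n => x xb; rewrite /eball /affine /= addr0 enormZ.
rewrite gtr0_norm ?invr_gt0// ltr_pdivrMl// mulr1.
apply: (@le_lt_trans _ _ n.+1%:R); last by rewrite ltr_nat.
rewrite -[leRHS]mulr1; apply: enorm_le_coord => // i.
by have := xb i; rewrite !mxE => /andP[h1 h2]; rewrite ger0_norm.
Qed.

Lemma unit_ball_lty n : (0 < n)%N -> (@lebesgue_n R n (eball 1) < +oo)%E.
Proof.
move=> n0; pose a : 'rV[R]_n := const_mx (-1); pose b : 'rV[R]_n := const_mx 1.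
apply: (@le_lt_trans _ _ (lebesgue_n (box a b))).
  apply: le_lebesgue_n => x x1 i; rewrite !mxE -ler_norml.
  by rewrite (le_trans (coord_le_enorm x i))// ltW.
apply: le_lt_trans (lebesgue_box_le n0 _) (ltry _) => i.
by rewrite !mxE lerNl.
Qed.

Lemma unit_ballE n : (0 < n)%N -> @lebesgue_n R n (eball 1) = (omega n)%:E.
Proof.
by move=> n0; rewrite fineK// fin_real// unit_ball_lty// (lt_trans _ (unit_ball_gt0 n)) ?ltNy0.
Qed.

Lemma omega_gt0 n : (0 < n)%N -> 0 < omega n :> R.
Proof. by move=> n0; rewrite -lte_fin -unit_ballE// unit_ball_gt0. Qed.

Lemma cball_volume n (x : 'rV[R]_n) r : (0 < n)%N -> 0 < r ->
  lebesgue_n (cball x r) = (r ^+ n * omega n)%:E.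
Proof.
move=> n0 r0; rewrite (lebesgue_affine x _ r0) EFinM -unit_ballE//; congr (_ * _)%E.
congr lebesgue_n; apply/seteqP; split=> y; rewrite /cball /affine /eball /=;
  by rewrite opprD addrCA subrr addr0 enormN enormZ gtr0_norm// gtr_pMr.
Qed.

Lemma eball_volume n r : (0 < n)%N -> 0 < r ->
  lebesgue_n (eball r : set 'rV[R]_n) = (r ^+ n * omega n)%:E.
Proof. by move=> n0 r0; rewrite eball_cball cball_volume. Qed.

Lemma measurable_eball n r : measurable (eball r : set (borel R n)).
Proof. by apply: open_borel; rewrite eball_cball; exact: open_cball. Qed.

Lemma measurable_esphere n r : measurable (esphere r : set (borel R n)).
Proof.
rewrite (_ : esphere r = (fun x : borel R n => enorm x) @^-1` [set r])//.
by rewrite -[X in measurable X]setTI; apply: measurable_enorm => //; exact: measurable_set1.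
Qed.

Lemma annulus_volume n (r s : R) : (0 < n)%N -> 0 < r -> r <= s ->
  lebesgue_n (eball s `\` eball r : set 'rV[R]_n) = ((s ^+ n - r ^+ n) * omega n)%:E.
Proof.
move=> n0 r0 rs; have s0 := lt_le_trans r0 rs.
have [m mE] := @lebesgue_borel_measure R n n0.
rewrite -mE measureD; [|exact: measurable_eball..|].
  rewrite /= !mE setIidr ?eball_volume// -?EFinB -?mulrBl//.
  by move=> x; rewrite /eball /= => /lt_le_trans; exact.
by rewrite /= mE eball_volume// ltry.
Qed.

Lemma sphere_null n (r : R) : (0 < n)%N -> 0 < r ->
  lebesgue_n (esphere r : set 'rV[R]_n) = 0%E.
Proof.
move=> n0 r0; apply: (@le_small_eq0 _ _ (n%:R * (r + 1) ^+ n.-1 * omega n)).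
  exact: lebesgue_n_ge0.
move=> e e0 e1; apply: (@le_trans _ _ (lebesgue_n (eball (r + e) `\` eball r : set 'rV[R]_n))).
  apply: le_lebesgue_n => x; rewrite /esphere /eball /= => ->; split.
    by rewrite ltrDl.
  by rewrite ltxx.
rewrite annulus_volume//; last by rewrite lerDl ltW.
rewrite lee_fin mulrA ler_wpM2r//; first by rewrite ltW// omega_gt0.
apply: le_trans (exprB_le _ (ltW r0) _) _; first by rewrite lerDl ltW.
rewrite addrAC subrr add0r ler_pM2l// ler_wpM2l//.
by rewrite lerXn2r ?nnegrE ?lerD2l// addr_ge0// ltW.
Qed.

Lemma origin_null n : (0 < n)%N -> lebesgue_n [set (0 : 'rV[R]_n)] = 0%E.
Proof.
move=> n0; apply/eqP; rewrite eq_le lebesgue_n_ge0 andbT.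
apply: (@le_trans _ _ (lebesgue_n (box (0%R : 'rV[R]_n) 0%R))).
  by apply: le_lebesgue_n => _ -> i; rewrite lexx.
apply: le_trans (lebesgue_box_le n0 _) _ => [i//|].
by rewrite (bigD1 (Ordinal n0))//= mxE subrr mul0r.
Qed.

End ball_volume.

(** * Uniformly distributed measures *)

Section double_counting.
Context {R : realType} {n : nat}.
Local Notation B := (borel R n).
Implicit Types (m : {measure set B -> \bar R}).

Lemma bigcup_eball : \bigcup_k eball k%:R = [set: 'rV[R]_n].
Proof.
apply/seteqP; split => // x _; exists (Num.truncn (enorm x)).+1 => //.
exact: truncnS_gt.
Qed.

Lemma sigma_finite_measure_of m :
  (forall k : nat, (m (eball k%:R) < +oo)%E) ->
  exists m' : {sigma_finite_measure set B -> \bar R},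
    m' = m :> (set B -> \bar R).
Proof.
move=> moo.
have sf : sigma_finite setT m.
  exists (fun k : nat => eball k%:R); first by rewrite bigcup_eball.
  by move=> k; split; [exact: measurable_eball|exact: moo].
pose M1 := isSFinite.Build _ _ _ _ (sfinite_measure_sigma_finite sf).
pose M2 := isSigmaFinite.Build _ _ _ _ sf.
pose m' := HB.pack_for (SigmaFiniteMeasure.type B R) (Measure.sort m) M1 M2.
by exists m'.
Qed.

(** Both sides compare with the measure of the pairs at distance less than
    [rho], sliced along either coordinate. *)
Lemma double_counting m1 m2 (U V : set B) (rho : R) (h k : \bar R) :
  (forall i : nat, (m1 (eball i%:R) < +oo)%E) ->
  (forall i : nat, (m2 (eball i%:R) < +oo)%E) ->
  measurable U -> measurable V -> (0 <= h)%E -> (0 <= k)%E ->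
  (forall x, V x -> (h <= m1 (cball x rho `&` U))%E) ->
  (forall y, U y -> (m2 (cball y rho) <= k)%E) ->
  (h * m2 V <= k * m1 U)%E.
Proof.
move=> /sigma_finite_measure_of[M1 M1E] /sigma_finite_measure_of[M2 M2E].
rewrite -M1E -M2E => mU mV h0 k0 hV kU.
pose A : set (B * B) := [set z | V z.1 /\ U z.2 /\ enorm (z.1 - z.2) < rho].
have mcoord i (f : B * B -> B) : measurable_fun setT f ->
    measurable_fun setT (fun z => f z ord0 i).
  by move=> mf; apply: (measurableT_comp (measurable_coord i)).
have mA : measurable A.
  have mN : measurable_fun setT (fun z : B * B => enorm (z.1 - z.2)).
    apply: (measurableT_comp measurable_enorm); apply: measurable_borel => i.
    rewrite (_ : (fun _ => _) = (fun z : B * B => z.1 ord0 i - z.2 ord0 i)); last first.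
      by apply/funext => z; rewrite !mxE.
    by apply: measurable_funB; apply: mcoord; [exact: measurable_fst|exact: measurable_snd].
  rewrite (_ : A = (fst @^-1` V) `&` ((snd @^-1` U) `&`
      ((fun z => enorm (z.1 - z.2)) @^-1` `]-oo, rho[%classic))); last first.
    by apply/seteqP; split=> z /=; rewrite in_itv.
  apply: measurableI; first by rewrite -[X in measurable X]setTI; exact: measurable_fst.
  apply: measurableI; first by rewrite -[X in measurable X]setTI; exact: measurable_snd.
  by rewrite -[X in measurable X]setTI; apply: mN => //; exact: measurable_itv.
have := indic_fubini_tonelli M2 M1 mA.
rewrite indic_fubini_tonelli_FE// indic_fubini_tonelli_GE// => fub.
apply: (@le_trans _ _ (\int[M2]_x (M1 \o xsection A) x)%E).
  rewrite -(integral_cst M2 mV h).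
  apply: (@le_trans _ _ (\int[M2]_(x in V) (M1 \o xsection A) x)%E).
    apply: ge0_le_integral => //.
    - by apply: measurable_funTS; exact: measurable_fun_xsection.
    - move=> x Vx; apply: le_trans (hV x Vx) _.
      apply: le_measure; rewrite ?inE; [|exact: measurable_xsection|].
        by apply: measurableI => //; apply: open_borel; exact: open_cball.
      by move=> y [xy Uy]; rewrite /xsection /= inE.
  apply: ge0_subset_integral => //; exact: measurable_fun_xsection.
rewrite fub -(integral_cst M1 mU k).
rewrite [leRHS]integral_mkcond.
apply: ge0_le_integral => //.
- exact: measurable_fun_ysection.
- by apply/(measurable_restrictT _ mU); exact: measurable_cst.
move=> y _; rewrite patchE; case: ifPn => [|]; rewrite ?inE ?notin_setE => Uy /=.
  apply: le_trans (kU y Uy).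
  apply: le_measure; rewrite ?inE; [exact: measurable_ysection| |].
    by apply: open_borel; exact: open_cball.
  by move=> x; rewrite /ysection /= inE => -[_ [_]]; rewrite /cball /= enormC.
rewrite (_ : ysection A y = set0) ?measure0//.
by apply/seteqP; split=> // x; rewrite /ysection /= inE => -[_ []].
Qed.

End double_counting.

Section image_measures.
Context {R : realType} d1 d2 (T1 : measurableType d1) (T2 : measurableType d2).

Lemma image_measure (m : {measure set T1 -> \bar R}) (f : T1 -> T2) :
  measurable_fun setT f ->
  exists m' : {measure set T2 -> \bar R}, forall E, m' E = m (f @^-1` E).
Proof.
move=> mf.
by exists (measure_function_pushforward__canonical__measure_function_Measure m mf).
Qed.

Lemma restricted_measure (m : {measure set T1 -> \bar R}) (D : set T1) :
  measurable D ->
  exists m' : {measure set T1 -> \bar R}, forall E, m' E = m (E `&` D).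
Proof.
move=> mD.
by exists (measure_function_mrestr__canonical__measure_function_Measure m mD).
Qed.

End image_measures.

Section uniform_measures.
Context {R : realType} {n : nat}.
Local Notation B := (borel R n).
Implicit Types (m : {measure set B -> \bar R}) (U S : set B).

(* The points of [U] at distance at least [1 / (j + 1)] from its complement. *)
Let inner U (j : nat) : set B := [set x | cball x j.+1%:R^-1 `<=` U].

Let inner_sub U j : inner U j `<=` U.
Proof. by move=> x; apply; rewrite /cball /= subrr enorm0 invr_gt0. Qed.

Let measurable_inner U j : measurable (inner U j).
Proof.
rewrite -[X in measurable X]setCK; apply: measurableC; apply: open_borel.
rewrite (_ : ~` _ = \bigcup_(y in ~` U) cball y j.+1%:R^-1).
  by apply: bigcup_open => y _; exact: open_cball.
apply/seteqP; split=> [x|x [y Uy xy] xU].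
  move=> /existsNP[y /not_implyP[xy Uy]]; exists y => //.
  by rewrite /cball /= enormC.
by apply/Uy/xU; rewrite /cball /= enormC.
Qed.

Let inner_nd U : nondecreasing_seq (inner U).
Proof.
move=> i j ij; apply/subsetPset => x xU y xy; apply: xU.
by apply: lt_le_trans xy _; rewrite lef_pV2 ?posrE// ler_nat.
Qed.

Let inner_bigcup U : open (U : set 'rV[R]_n) -> \bigcup_j inner U j = U.
Proof.
move=> oU; apply/seteqP; split=> [x [j _]|x Ux]; first exact: inner_sub.
have [e e0 xeU] := (open_enormP U).1 oU x Ux.
have [j je] := exists_invS_lt e0; exists j => // y xy.
by apply: xeU; exact: lt_trans je.
Qed.

(** An open set is exhausted by the sets of the points that keep a given
    distance from its complement. *)
Lemma le_measure_inner m S U (C : \bar R) : measurable S ->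
  open (U : set 'rV[R]_n) -> (forall j, (m (inner U j `&` S) <= C)%E) ->
  (m (U `&` S) <= C)%E.
Proof.
move=> mS oU mC; have mI j : measurable (inner U j `&` S).
  by apply: measurableI.
have := @nondecreasing_cvg_mu _ _ _ m (fun j => inner U j `&` S) mI.
rewrite -setI_bigcupl inner_bigcup// => /(_ _ _)/cvg_lim <-//.
- apply: lime_le; last by apply: nearW => j; exact: mC.
  apply/cvg_ex; exists (m (U `&` S)).
  rewrite -[in X in _ --> X](inner_bigcup oU) setI_bigcupl.
  apply: nondecreasing_cvg_mu => //.
    by apply: bigcupT_measurable.
  by move=> i j ij; apply/subsetPset; apply: setSI; apply/subsetPset; exact: inner_nd.
- by apply: measurableI => //; exact: open_borel.
- by move=> i j ij; apply/subsetPset; apply: setSI; apply/subsetPset; exact: inner_nd.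
Qed.

Lemma measurable_isometry (T : 'rV[R]_n -> 'rV[R]_n) :
  (forall x y, enorm (T x - T y) = enorm (x - y)) ->
  measurable_fun setT (T : B -> B).
Proof.
move=> Tiso _ E mE; rewrite setTI.
apply: (@borel_preimage_measurable R n _ B T) mE => i a.
rewrite -[X in measurable X]setCK; apply: measurableC; apply: open_borel.
apply/open_enormP => x /negP; rewrite -ltNge => ax.
exists (T x ord0 i - a); first by rewrite subr_gt0.
move=> y; rewrite -Tiso => xy /=; apply/negP; rewrite -ltNge.
have := le_lt_trans (coord_le_enorm (T x - T y) i) xy.
by rewrite !mxE => /(le_lt_trans (ler_norm _)); rewrite ltrD2l ltrN2.
Qed.

Lemma eball0 : eball 0 = set0 :> set 'rV[R]_n.
Proof. by apply/seteqP; split=> // x; rewrite /eball /= ltNge enorm_ge0. Qed.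

(** An isometric involution maps balls to balls of the same radius, so the
    image of Lebesgue measure and Lebesgue measure itself give all balls the
    same mass, and double counting compares them on open sets. *)
Lemma lebesgue_involution_open (T : 'rV[R]_n -> 'rV[R]_n) U : (0 < n)%N ->
  involutive T -> (forall x y, enorm (T x - T y) = enorm (x - y)) ->
  open (U : set 'rV[R]_n) -> lebesgue_n (T @^-1` U) = lebesgue_n U.
Proof.
move=> n0 TT Tiso.
have Tball x r : T @^-1` cball x r = cball (T x) r.
  by apply/seteqP; split=> y; rewrite /cball /= -Tiso TT.
have To V : open V -> open (T @^-1` V).
  move=> /open_enormP oV; apply/open_enormP => x /oV[e e0 xe].
  by exists e => // y xy; apply: xe; rewrite Tiso.
have mT : measurable_fun setT (T : B -> B) by exact: measurable_isometry.
have [m mE] := @lebesgue_borel_measure R n n0.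
have [m' m'E] := image_measure m mT.
have m'ball x r : 0 < r -> m' (cball x r) = (r ^+ n * omega n)%:E.
  by move=> r0; rewrite m'E mE Tball cball_volume.
have mball x r : 0 < r -> m (cball x r) = (r ^+ n * omega n)%:E.
  by move=> r0; rewrite mE cball_volume.
have fin0 m0 : (forall x r, 0 < r -> m0 (cball x r) = (r ^+ n * omega n)%:E) ->
   forall k : nat, (m0 (eball k%:R : set B) < +oo)%E.
  move=> h [|k]; last by rewrite eball_cball h// ltry.
  by rewrite eball0 measure0.
suff le V : open (V : set 'rV[R]_n) -> (m' V <= m V)%E.
  move=> oU; apply/eqP; rewrite eq_le -!mE -m'E le//=.
  rewrite (_ : m U = m' (T @^-1` U)).
    by rewrite [leRHS]m'E; apply: le; exact: To.
  by rewrite m'E -comp_preimage; congr (m _); apply/seteqP; split=> x /=; rewrite TT.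
move=> oV; rewrite -[V in m' V]setIT.
apply: le_measure_inner => // j; rewrite setIT.
set rho : R := j.+1%:R^-1; have rho0 : 0 < rho by rewrite invr_gt0.
have vol0 : 0 < rho ^+ n * omega n :> R by rewrite mulr_gt0 ?exprn_gt0 ?omega_gt0.
have := @double_counting R n m m' V (inner V j) rho (rho ^+ n * omega n)%:E
  (rho ^+ n * omega n)%:E.
rewrite lee_pmul2l//; apply => //.
- exact: fin0.
- exact: fin0.
- exact: open_borel.
- by rewrite lee_fin ltW.
- by rewrite lee_fin ltW.
- by move=> x xV; rewrite -(mball x)// setIidl.
- by move=> y _; rewrite m'ball.
Qed.

Lemma lebesgue_involution (T : 'rV[R]_n -> 'rV[R]_n) (E : set B) : (0 < n)%N ->
  involutive T -> (forall x y, enorm (T x - T y) = enorm (x - y)) ->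
  measurable E -> lebesgue_n (T @^-1` E) = lebesgue_n E.
Proof.
move=> n0 TT Tiso mE.
have mT : measurable_fun setT (T : B -> B) by exact: measurable_isometry.
have [m mE'] := @lebesgue_borel_measure R n n0.
have [m' m'E] := image_measure m mT.
rewrite -!mE' -m'E.
apply: (@g_sigma_algebra_measure_unique _ _ B (open : set (set B)) _
  (fun k => eball k%:R)) mE.
- by move=> U oU; exact: open_borel.
- by move=> k; rewrite eball_cball; exact: open_cball.
- exact: bigcup_eball.
- exact: openI.
- by move=> U oU; rewrite m'E /= !mE' lebesgue_involution_open.
move=> k; rewrite m'E /= mE' lebesgue_involution_open//; last first.
  by rewrite eball_cball; exact: open_cball.
by case: k => [|k]; [rewrite eball0 -mE' measure0 ltry|rewrite eball_volume// ltry].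
Qed.

Section uniqueness.
Variables (S : set B).
Hypothesis mS : measurable S.

Definition uniform_on m := (forall E, measurable E -> m E = m (E `&` S)) /\
  forall x y r, S x -> S y -> 0 < r -> m (cball x r) = m (cball y r).

(* Double counting compares the masses of an open set up to the ratio of the
   masses of balls at the given scale; applied to the whole of [S], in both
   directions, it shows that this ratio is the ratio of the total masses. *)
Let le_uniform m1 m2 U : (m1 setT < +oo)%E -> (m2 setT < +oo)%E ->
  uniform_on m1 -> uniform_on m2 ->
  (forall x r, S x -> 0 < r -> (0 < m1 (cball x r))%E) ->
  open (U : set 'rV[R]_n) -> (m1 S * m2 U <= m2 S * m1 U)%E.
Proof.
move=> m1oo m2oo [m1S m1u] [m2S m2u] m1pos oU.
have [->|/set0P[x0 Sx0]] := eqVneq S set0; first by rewrite !measure0 !mul0e.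
have fin m E : (m setT < +oo)%E -> measurable E -> m E \is a fin_num.
  move=> moo mE; rewrite ge0_fin_numE//; apply: le_lt_trans moo.
  by apply: le_measure; rewrite ?inE.
have fin1 E : measurable E -> m1 E \is a fin_num by exact: fin.
have fin2 E : measurable E -> m2 E \is a fin_num by exact: fin.
have mU : measurable U by exact: open_borel.
have mB x r : measurable (cball x r : set B) by apply: open_borel; exact: open_cball.
have lf m : (m setT < +oo)%E -> forall k : nat, (m (eball k%:R) < +oo)%E.
  by move=> moo k; rewrite ltey_eq fin//; exact: measurable_eball.
have dc m m' (V W : set B) (r : R) : (m setT < +oo)%E -> (m' setT < +oo)%E ->
  uniform_on m -> uniform_on m' -> measurable V -> measurable W -> 0 < r ->
  (forall x : 'rV[R]_n, V x -> cball x r `<=` W) ->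
  (m (cball x0 r) * m' (V `&` S) <= m' (cball x0 r) * m (W `&` S))%E.
  move=> moo m'oo [h1 h2] [h'1 h'2] mV mW r0 VW.
  apply: (@double_counting R n m m' (W `&` S) (V `&` S) r) => //; try exact: lf;
    try exact: measurableI.
  - by move=> x [Vx Sx]; rewrite (h2 x0 x r)// h1// setIA (setIidl (VW x Vx)).
  - by move=> y [_ Sy]; rewrite (h'2 y x0).
have tot (r : R) : 0 < r -> (m1 (cball x0 r) * m2 S = m2 (cball x0 r) * m1 S)%E.
  move=> r0; apply/eqP; rewrite eq_le.
  have h12 := dc m1 m2 setT setT r m1oo m2oo (conj m1S m1u) (conj m2S m2u).
  have h21 := dc m2 m1 setT setT r m2oo m1oo (conj m2S m2u) (conj m1S m1u).
  by rewrite !setTI in h12 h21; rewrite h12// h21.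
rewrite (m1S U)// (m2S U)//.
have [->|m10] := eqVneq (m1 S) 0%E; first by rewrite mul0e mule_ge0.
have m1S0 : (0 < m1 S)%E by rewrite lt_neqAle eq_sym m10 measure_ge0.
have real E m : (m setT < +oo)%E -> measurable E -> m E = (fine (m E))%:E.
  by move=> moo mE; rewrite fineK// fin.
have fine1 E : measurable E -> m1 E = (fine (m1 E))%:E by exact: real.
have fine2 E : measurable E -> m2 E = (fine (m2 E))%:E by exact: real.
have mUS : measurable (U `&` S) by exact: measurableI.
rewrite (fine1 S)// -lee_pdivlMl; last by rewrite -lte_fin -fine1.
apply: le_measure_inner => // j.
rewrite lee_pdivlMl; last by rewrite -lte_fin -fine1.
have mI : measurable (inner U j `&` S) by apply: measurableI.
have r0 : 0 < j.+1%:R^-1 :> R by rewrite invr_gt0.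
have := dc m1 m2 (inner U j) U _ m1oo m2oo (conj m1S m1u) (conj m2S m2u)
  (measurable_inner U j) mU r0 (fun x xU => xU).
have := tot _ r0; have := m1pos _ _ Sx0 r0.
rewrite (fine1 S)// (fine2 S)// (fine1 (cball x0 _))// (fine2 (cball x0 _))//.
rewrite (fine1 (U `&` S))// (fine2 (_ `&` S))//.
have a0 : 0 <= fine (m1 S) by rewrite fine_ge0.
rewrite -!EFinM !lee_fin lte_fin => h0 [hbka] huv.
rewrite -(ler_pM2l h0) mulrCA [leRHS]mulrA hbka [leRHS]mulrAC [leRHS]mulrC.
exact: ler_wpM2l.
Qed.
(** Christensen's lemma.  By [le_uniform], applied twice, the multiples of the
    two measures agree on open sets, which determine them. *)
Lemma uniform_unique m1 m2 : (m1 setT < +oo)%E -> (m2 setT < +oo)%E ->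
  uniform_on m1 -> uniform_on m2 ->
  (forall x r, S x -> 0 < r -> (0 < m1 (cball x r))%E) ->
  (forall x r, S x -> 0 < r -> (0 < m2 (cball x r))%E) ->
  forall E, measurable E -> (m1 S * m2 E = m2 S * m1 E)%E.
Proof.
move=> m1oo m2oo u1 u2 p1 p2 E mE.
have fin m : (m setT < +oo)%E -> m S \is a fin_num.
  move=> moo; rewrite ge0_fin_numE//; apply: le_lt_trans moo.
  by apply: le_measure; rewrite ?inE.
have f0 m : 0 <= fine (m S) by rewrite fine_ge0.
pose M1 := mscale (NngNum (f0 m2)) m1; pose M2 := mscale (NngNum (f0 m1)) m2.
suff : M1 E = M2 E by rewrite /M1 /M2 /mscale/= !fineK ?fin.
apply: (@g_sigma_algebra_measure_unique _ _ B (open : set (set B)) _ (fun=> setT)) => //.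
- by move=> U oU; exact: open_borel.
- by move=> _; exact: openT.
- by rewrite bigcup_const.
- exact: openI.
- move=> U oU; rewrite /M1 /M2 /= /mscale/= !fineK ?fin//.
  by apply/eqP; rewrite eq_le !le_uniform.
- by move=> _; rewrite /M1 /= /mscale /= lte_mul_pinfty// ?lee_fin//; exact: m1oo.
Qed.

End uniqueness.
End uniform_measures.

(** * Hausdorff measure *)

Section metric_outer_measure.
Context {R : realType} {n : nat}.
Variable mu : {outer_measure set 'rV[R]_n -> \bar R}.
Hypothesis mu_separated : forall (A B : set 'rV[R]_n) (e : R), 0 < e ->
  (forall x y, A x -> B y -> e <= enorm (x - y)) ->
  (mu A + mu B <= mu (A `|` B))%E.

(** Caratheodory's criterion.  The part of [X] outside the half-space is
    exhausted by the sets [D k] at positive distance from the half-space; what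
    [D k] misses is a union of strips, and the masses of the strips form a
    convergent series, because the strip number [k + 1] is separated from [D k]
    and both lie in [D (k + 2)], so that the sum telescopes. *)
Lemma metric_half_space_caratheodory i a :
  mu.-caratheodory [set x | x ord0 i <= a].
Proof.
set H := [set x | _]; apply: le_caratheodory_measurable => X.
have [->|Xoo] := eqVneq (mu X) +oo%E; first exact: leey.
have muX : mu X \is a fin_num by rewrite ge0_fin_numE ?outer_measure_ge0// ltey.
pose e k : R := k.+1%:R^-1.
pose D k := X `&` [set x | a + e k <= x ord0 i].
pose S k := X `&` [set x | a + e k.+1 <= x ord0 i < a + e k].
have e_gt0 k : 0 < e k by rewrite invr_gt0.
have e_lt k : e k.+1 < e k by rewrite ltf_pV2 ?posrE// ltr_nat.
have D_sub k : D k `<=` D k.+1.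
  by move=> x [Xx xk]; split => //; apply: le_trans xk; rewrite lerD2l ltW.
have S_sub k : S k `<=` D k.+1 by move=> x [Xx /andP[]].
have muD k : mu (D k) \is a fin_num.
  rewrite ge0_fin_numE ?outer_measure_ge0//; apply: le_lt_trans (_ : mu X < _)%E.
    by apply: le_outer_measure; exact: subIsetl.
  by rewrite ltey.
have sep (x y : 'rV[R]_n) c d : x ord0 i <= c -> d <= y ord0 i -> d - c <= enorm (x - y).
  move=> xc dy; apply: le_trans (coord_le_enorm (x - y) i).
  by rewrite !mxE distrC (le_trans _ (ler_norm _))// lerB.
have telescope k : (mu (S k.+1) + mu (D k) <= mu (D k.+2))%E.
  apply: le_trans (mu_separated (e := e k - e k.+1) _ _) _.
  - by rewrite subr_gt0.
  - move=> x y [_ /andP[_ xk]] [_ yk].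
    have -> : e k - e k.+1 = (a + e k) - (a + e k.+1) by ring.
    by apply: sep => //; exact: ltW.
  - apply: le_outer_measure => x [/S_sub//|]; by move=> /D_sub/D_sub.
have sumS N : (\sum_(0 <= k < N) mu (S k.+1) <= mu (D N) + mu (D N.+1))%E.
  elim: N => [|N IH]; first by rewrite big_geq// adde_ge0// outer_measure_ge0.
  rewrite big_nat_recr//=; apply: le_trans (leeD2r _ IH) _.
  rewrite addeC addeA [leRHS]addeC; apply: leeD2r; exact: telescope.
have S_fin : (\sum_(0 <= k <oo) mu (S k.+1) < +oo)%E.
  apply: (@le_lt_trans _ _ (mu X + mu X)%E); last by rewrite lte_add_pinfty// ltey.
  apply: lime_le; first by apply: is_cvg_nneseries => *; exact: outer_measure_ge0.
  apply: nearW => N; apply: le_trans (sumS N) _.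
  by apply: leeD; apply: le_outer_measure; exact: subIsetl.
have tail := nneseries_tail_cvg S_fin (fun k _ => outer_measure_ge0 mu (S k.+1)).
have lim : (mu X + \sum_(k <= j <oo) mu (S j.+1))%E @[k --> \oo] --> (mu X + 0)%E.
  by apply: cvgeD => //; [rewrite fin_num_adde_defr|exact: cvg_cst].
rewrite -[leRHS]adde0; apply: cvge_ge lim; apply: nearW => k.
apply: (@le_trans _ _ (mu (X `&` H) + (mu (D k.+1) +
    \sum_(k <= j <oo) mu (S j.+1)))%E).
  apply: leeD => //; apply: le_trans (leeD (lexx _) _); last first.
    exact: outer_measure_sigma_subadditive_tail.
  apply: le_trans (outer_measureU2 _ _ _); apply: le_outer_measure => x [Xx /negP].
  rewrite -ltNge => ax.
  have [xk|xk] := leP (a + e k.+1) (x ord0 i); [by left|right].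
  have ax0 : 0 < x ord0 i - a by rewrite subr_gt0.
  have [m me] := exists_invS_lt ax0.
  have Pm : exists m, a + e m <= x ord0 i by exists m; rewrite -lerBrDl ltW.
  case: (ex_minnP Pm) => j xj jmin.
  have kj : (k.+1 < j)%N.
    rewrite ltnNge; apply/negP => jk; move: xk; rewrite ltNge (le_trans _ xj)//.
    by rewrite lerD2l lef_pV2 ?posrE// ler_nat.
  case: j kj xj jmin => [//|[//|j]] kj xj jmin.
  exists j => /=; first by apply/negP; rewrite -leqNgt.
  split => //=; rewrite xj ltNge; apply/negP => /jmin; by rewrite ltnn.
rewrite addeA; apply: leeD => //; apply: le_trans (mu_separated (e_gt0 k.+1) _) _.
  move=> x y [_ xa] [_ ya]; rewrite -[e _](addrK a) [e _ + a]addrC; exact: sep.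
by apply: le_outer_measure => x [[]|[]].
Qed.

End metric_outer_measure.

Section hausdorff_lemmas.
Context {R : realType} {n : nat}.
Implicit Types (A : set 'rV[R]_n) (m : nat) (delta : R).

Lemma ediam_ge0 A : 0 <= ediam A.
Proof.
rewrite /ediam; set D := [set _ | _].
have [[[d Dd] ubD]|/sup_out ->//] := pselect (has_sup D).
apply: le_trans (sup_upper_bound (conj (ex_intro _ d Dd) ubD) Dd).
by case: Dd => x [y [_ _ ->]]; exact: enorm_ge0.
Qed.

Lemma ediam_set0 : ediam (set0 : set 'rV[R]_n) = 0.
Proof.
rewrite /ediam (_ : [set _ | _] = set0) ?sup0//.
by apply/seteqP; split=> // d [x [y []]].
Qed.

Lemma ediam_ge A delta x y : (forall x y, A x -> A y -> enorm (x - y) <= delta) ->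
  A x -> A y -> enorm (x - y) <= ediam A.
Proof.
move=> Ad Ax Ay; apply: ub_le_sup; last by exists x, y.
by exists delta => _ [u [v [Au Av ->]]]; exact: Ad.
Qed.

Lemma ediam_le A delta : 0 <= delta ->
  (forall x y, A x -> A y -> enorm (x - y) <= delta) -> ediam A <= delta.
Proof.
move=> d0 Ad; have [->|/set0P[x Ax]] := eqVneq A set0; first by rewrite ediam_set0.
apply: ge_sup; first by exists (enorm (x - x)), x, x.
by move=> _ [u [v [Au Av ->]]]; exact: Ad.
Qed.

Let small delta A := forall x y, A x -> A y -> enorm (x - y) <= delta.
Let gauge m A : R := omega m * (ediam A / 2) ^+ m.

Let hausdorff_deltaE m delta :
  @hausdorff_delta R n m delta = cover_inf (small delta) id (gauge m).
Proof. by []. Qed.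

Let omega_ge0 m : 0 <= omega m :> R.
Proof. by rewrite fine_ge0// lebesgue_n_ge0. Qed.

Lemma gauge_ge0 m A : 0 <= omega m * (ediam A / 2) ^+ m.
Proof. by rewrite mulr_ge0// exprn_ge0// divr_ge0// ediam_ge0. Qed.

Lemma gauge_set0 m : (0 < m)%N ->
  omega m * (ediam (set0 : set 'rV[R]_n) / 2) ^+ m = 0.
Proof. by move=> m0; rewrite ediam_set0 mul0r expr0n gtn_eqF// mulr0. Qed.

Lemma hausdorff_delta_ge0 m delta A : (0 <= hausdorff_delta m delta A)%E.
Proof. by rewrite hausdorff_deltaE; apply: cover_inf_ge0 => *; exact: gauge_ge0. Qed.

Lemma hausdorff_delta_le_hausdorff m delta A : 0 < delta ->
  (hausdorff_delta m delta A <= hausdorff m A)%E.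
Proof. by move=> d0; apply: ereal_sup_ubound; exists delta. Qed.

Lemma hausdorff_delta_anti m delta delta' A : delta <= delta' ->
  (hausdorff_delta m delta' A <= hausdorff_delta m delta A)%E.
Proof.
move=> dd; apply: ereal_inf_le_tmp => _ [F [Fd AF] <-]; exists F => //.
by split=> // k x y Fx Fy; apply: le_trans dd; exact: Fd Fx Fy.
Qed.

Lemma hausdorff_outer_measure m : (0 < m)%N ->
  exists mu : {outer_measure set 'rV[R]_n -> \bar R},
    mu = @hausdorff R n m :> (set 'rV[R]_n -> \bar R).
Proof.
move=> m0.
have out delta : exists mu : {outer_measure set 'rV[R]_n -> \bar R},
    mu = @hausdorff_delta R n m delta :> (set 'rV[R]_n -> \bar R).
  rewrite hausdorff_deltaE; apply: (@cover_outer_measure _ _ _ _ _ _ _ set0) => //.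
    by move=> *; exact: gauge_ge0.
  exact: gauge_set0.
have h0 : @hausdorff R n m set0 = 0%E.
  apply/eqP; rewrite eq_le; apply/andP; split.
    apply: ge_ereal_sup => _ [d d0 <-].
    by have [mu <-] := out d; rewrite outer_measure0.
  by apply: le_trans (hausdorff_delta_ge0 m 1 _) (hausdorff_delta_le_hausdorff _ _ _).
have hge0 A : (0 <= hausdorff m A)%E.
  by apply: le_trans (hausdorff_delta_ge0 m 1 _) (hausdorff_delta_le_hausdorff _ _ _).
have hle : {homo @hausdorff R n m : A B / A `<=` B >-> (A <= B)%E}.
  move=> A B AB; apply: ge_ereal_sup => _ [d d0 <-].
  apply: le_trans (hausdorff_delta_le_hausdorff m B d0).
  by have [mu <-] := out d; exact: le_outer_measure.
have hsub : sigma_subadditive (@hausdorff R n m).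
  move=> F; apply: ge_ereal_sup => _ [d d0 <-].
  apply: (@le_trans _ _ (\sum_(i <oo) hausdorff_delta m d (F i))%E).
    by have [mu <-] := out d; exact: outer_measure_sigma_subadditive.
  apply: lee_nneseries => i _; first by move=> _; exact: hausdorff_delta_ge0.
  exact: hausdorff_delta_le_hausdorff.
pose M := isOuterMeasure.Build R 'rV[R]_n (@hausdorff R n m) h0 hge0 hle hsub.
pose mu : {outer_measure set 'rV[R]_n -> \bar R} := HB.pack (@hausdorff R n m) M.
by exists mu.
Qed.

(** A set of diameter less than [e] cannot meet both [A] and [B], so a fine
    cover of the union splits into a cover of [A] and a cover of [B]. *)
Let hausdorff_delta_separated m (A B : set 'rV[R]_n) (e delta : R) : (0 < m)%N ->
  delta < e -> (forall x y, A x -> B y -> e <= enorm (x - y)) ->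
  (hausdorff_delta m delta A + hausdorff_delta m delta B <=
   hausdorff_delta m delta (A `|` B))%E.
Proof.
move=> m0 de AB; apply: le_ereal_inf_tmp => _ [F [Fd cF] <-].
pose meets k := `[< F k `&` A !=set0 >].
pose FA k := if meets k then F k else set0.
pose FB k := if meets k then set0 else F k.
have split_gauge k : gauge m (F k) = gauge m (FA k) + gauge m (FB k).
  by rewrite /FA /FB; case: ifP; rewrite /gauge gauge_set0// (addr0, add0r).
under eq_eseriesr => k _ do rewrite -/(gauge m (F k)) split_gauge EFinD.
rewrite nneseriesD; [|by move=> *; rewrite lee_fin; exact: gauge_ge0..].
apply: leeD; apply: ereal_inf_lbound.
- exists FA => //; split=> [k x y|x Ax].
    by rewrite /FA; case: ifP => // _; exact: Fd.
  have [|k _ Fx] := cF x; first by left.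
  by exists k => //; rewrite /FA /meets; case: asboolP => // -[]; exists x.
- exists FB => //; split=> [k x y|x Bx].
    by rewrite /FB; case: ifP => // _; exact: Fd.
  have [|k _ Fx] := cF x; first by right.
  exists k => //; rewrite /FB /meets; case: asboolP => // -[y [Fy Ay]].
  by have := le_trans (AB _ _ Ay Bx) (Fd _ _ _ Fy Fx); rewrite leNgt de.
Qed.

Lemma hausdorff_separated m (A B : set 'rV[R]_n) (e : R) : (0 < m)%N -> 0 < e ->
  (forall x y, A x -> B y -> e <= enorm (x - y)) ->
  (hausdorff m A + hausdorff m B <= hausdorff m (A `|` B))%E.
Proof.
move=> m0 e0 AB; set M := hausdorff m (A `|` B).
have [->|Moo] := eqVneq M +oo%E; first exact: leey.
(* Both scales are refined to a common one that is smaller than [e]. *)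
have le2 d d' : 0 < d -> 0 < d' ->
    (hausdorff_delta m d A + hausdorff_delta m d' B <= M)%E.
  move=> d0 d'0; pose c := Num.min (Num.min d d') (e / 2).
  have c0 : 0 < c by rewrite !lt_min d0 d'0 divr_gt0.
  apply: (@le_trans _ _ (hausdorff_delta m c A + hausdorff_delta m c B)%E).
    by apply: leeD; apply: hausdorff_delta_anti; rewrite !ge_min lexx ?orbT.
  apply: le_trans (hausdorff_delta_le_hausdorff m _ c0).
  apply: hausdorff_delta_separated AB => //.
  by rewrite gt_min ltr_pdivrMr// mulr_natr mulr2n ltrDl e0 orbT.
have M_ge0 : (0 <= M)%E.
  by apply: le_trans (hausdorff_delta_ge0 m 1 _) (hausdorff_delta_le_hausdorff _ _ _).
have finl x y : (0 <= x)%E -> (0 <= y)%E -> (x + y <= M)%E -> y \is a fin_num.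
  move=> x0 y0 xyM; rewrite ge0_fin_numE//; apply: (@le_lt_trans _ _ M); last by rewrite ltey.
  by apply: le_trans xyM; rewrite leeDr.
have HA d' : 0 < d' -> (hausdorff m A + hausdorff_delta m d' B <= M)%E.
  move=> d'0; have fB := finl _ _ (hausdorff_delta_ge0 _ _ _) (hausdorff_delta_ge0 _ _ _)
    (le2 1 d' ltr01 d'0).
  rewrite -leeBrDr//; apply: ge_ereal_sup => _ [d d0 <-].
  by rewrite leeBrDr// le2.
have hA0 : (0 <= hausdorff m A)%E.
  by apply: le_trans (hausdorff_delta_ge0 m 1 _) (hausdorff_delta_le_hausdorff _ _ _).
have fA : hausdorff m A \is a fin_num.
  by apply: (finl (hausdorff_delta m 1 B)) => //; [exact: hausdorff_delta_ge0|rewrite addeC HA].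
rewrite addeC -leeBrDr//; apply: ge_ereal_sup => _ [d d0 <-].
by rewrite leeBrDr// addeC HA.
Qed.

Lemma hausdorff_borel_measure m : (0 < m)%N ->
  exists M : {measure set (borel R n) -> \bar R},
    forall E : set 'rV[R]_n, M E = hausdorff m E.
Proof.
move=> m0; have [mu muE] := hausdorff_outer_measure m0.
rewrite -muE; apply: caratheodory_borel_measure => i a.
apply: metric_half_space_caratheodory => A B e e0 AB.
by rewrite muE; exact: hausdorff_separated AB.
Qed.

Lemma hausdorff_involution m (T : 'rV[R]_n -> 'rV[R]_n) A : involutive T ->
  (forall x y, enorm (T x - T y) = enorm (x - y)) ->
  hausdorff m (T @^-1` A) = hausdorff m A.
Proof.
move=> TT Tiso.
have Tdiam B : ediam (T @^-1` B) = ediam B.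
  congr sup; apply/seteqP; split=> d [x [y [Bx By ->]]].
    by exists (T x), (T y); rewrite Tiso.
  by exists (T x), (T y); rewrite Tiso /= !TT.
have le d B : (hausdorff_delta m d (T @^-1` B) <= hausdorff_delta m d B)%E.
  apply: le_ereal_inf_tmp => _ [F [Fd BF] <-]; apply: ereal_inf_lbound.
  exists (fun k => T @^-1` F k); last by apply: eq_eseriesr => k _; rewrite Tdiam.
  split=> [k x y Fx Fy|x /BF[k _ Fx]]; last by exists k.
  by rewrite -Tiso; exact: Fd Fx Fy.
rewrite /hausdorff; congr (ereal_sup (image _ _)); apply/funext => d.
apply/eqP; rewrite eq_le le/= (_ : A = T @^-1` (T @^-1` A)).
  rewrite [X in (_ <= hausdorff_delta _ _ X)%E](_ : _ = T @^-1` A) ?le//.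
  by apply/seteqP; split=> x /=; rewrite TT.
by apply/seteqP; split=> x /=; rewrite TT.
Qed.

End hausdorff_lemmas.

(** * Cones over subsets of a sphere *)

Definition proj_sphere {R : realType} {n} (r : R) (q : 'rV[R]_n) : 'rV[R]_n :=
  (r / enorm q) *: q.

(** The truncated cone with apex 0 over the part of [A] that lies on the sphere
    of radius [r].  The apex has to be left out because [proj_sphere r 0 = 0]. *)
Definition tcone {R : realType} {n} (t r : R) (A : set 'rV[R]_n) : set 'rV[R]_n :=
  [set q | [/\ q != 0, enorm q < t & A (proj_sphere r q)]].

Local Notation cone := (tcone 1%R).

Section cones.
Context {R : realType} {n : nat}.
Hypothesis n0 : (0 < n)%N.
Implicit Types (x y q : 'rV[R]_n) (A F : set 'rV[R]_n).
Variable r : R.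
Hypothesis r0 : 0 < r.

Lemma enorm_proj q : q != 0 -> enorm (proj_sphere r q) = r.
Proof.
move=> q0; have eq0 : 0 < enorm q by rewrite enorm_gt0.
by rewrite enormZ gtr0_norm ?divr_gt0// divfK ?gt_eqF.
Qed.

Lemma cone_sphere A : cone r (A `&` esphere r) = cone r A.
Proof.
apply/seteqP; split=> q [qn0 q1]; first by case.
by move=> Aq; split=> //; split=> //; exact: enorm_proj.
Qed.

Lemma cone_full : cone r (esphere r : set 'rV[R]_n) `|` [set 0] = eball 1.
Proof.
apply/seteqP; split=> q; first by case=> [[]//|->]; rewrite /eball /= enorm0.
move=> q1; have [->|qn0] := eqVneq q 0; [by right|left; split => //].
exact: enorm_proj.
Qed.

Lemma cone_full_volume :
  lebesgue_n (cone r (esphere r : set 'rV[R]_n)) = (omega n)%:E.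
Proof.
have [mu muE] := @lebesgue_outer_measure R n n0.
apply/eqP; rewrite -unit_ballE// eq_le -{1}cone_full le_lebesgue_n; last by left.
rewrite -{1}cone_full -muE; apply: le_trans (outer_measureU2 mu _ _) _.
by rewrite muE origin_null// adde0.
Qed.

(** The cone over a set of diameter [d] lies in a tube of length 1, which is
    covered by about [1 / d] balls of radius comparable to [d]. *)
Lemma cone_small_volume F (d : R) : 0 < d -> d <= 1 ->
  (forall x y, F x -> F y -> enorm (x - y) <= d) ->
  (lebesgue_n (cone r F) <=
     (2 * (r^-1 + 1) ^+ n * omega n * d ^+ n.-1)%:E)%E.
Proof.
move=> d0 d1 Fd.
have [mu muE] := @lebesgue_outer_measure R n n0.
have [->|/set0P[q0 [q0n0 _ Fx]]] := eqVneq (cone r F) set0.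
  by rewrite -muE outer_measure0 lee_fin !mulr_ge0 ?exprn_ge0 ?addr_ge0 ?invr_ge0 ?ltW ?omega_gt0.
set x := proj_sphere r q0 in Fx; have xr : enorm x = r by exact: enorm_proj.
clearbody x.
pose D := r^-1 + 1; have D0 : 0 < D by rewrite addr_gt0// invr_gt0.
pose J := (Num.truncn d^-1).+1.
pose ball_ (j : nat) := cball ((j%:R * d / r) *: x) (d * D).
have sub : cone r F `<=` \big[setU/set0]_(j < J) ball_ j.
  move=> q [qn0 q1 Fy]; have eq0 : 0 < enorm q by rewrite enorm_gt0.
  pose t := enorm q; pose j := Num.truncn (t / d).
  have /andP[jt tj] : j%:R <= t / d < j.+1%:R.
    by apply: truncn_itv; rewrite divr_ge0// ltW.
  have jJ : (j < J)%N.
    rewrite -(ltr_nat R); apply: le_lt_trans jt _; apply: lt_trans (truncnS_gt _).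
    by rewrite ltr_pdivrMr// mulVf ?gt_eqF.
  rewrite -bigcup_mkord; exists j => //; rewrite /ball_ /cball /=.
  have qE : q = (t / r) *: proj_sphere r q.
    by rewrite scalerA mulrA divfK ?gt_eqF// divff ?gt_eqF// scale1r.
  have -> : (j%:R * d / r) *: x - q =
      ((j%:R * d - t) / r) *: x + (t / r) *: (x - proj_sphere r q).
    by rewrite scalerBr -qE addrA -scalerDl; congr (_ *: _ - _); ring.
  apply: le_lt_trans (ler_enormD _ _) _; rewrite !enormZ xr.
  have jd : j%:R * d <= t by rewrite -ler_pdivlMr.
  have jd' : t < j%:R * d + d by move: tj; rewrite ltr_pdivrMr// -natr1 mulrDl mul1r.
  rewrite normrM (ler0_norm (_ : j%:R * d - t <= 0)) ?subr_le0// opprB.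
  rewrite (gtr0_norm (_ : 0 < r^-1)) ?invr_gt0// divfK ?gt_eqF//.
  rewrite gtr0_norm ?divr_gt0// /D mulrDr mulr1 addrC ler_ltD//; last by rewrite ltrBlDl.
  have h := Fd _ _ Fx Fy.
  apply: (@le_trans _ _ (t / r * d)); first by rewrite ler_wpM2l// divr_ge0// ltW.
  by rewrite mulrC ler_pM2l// ler_pdivrMr// mulVf ?gt_eqF// ltW.
apply: le_trans (le_lebesgue_n sub) _; rewrite -muE.
apply: le_trans (outer_measure_subadditive mu ball_ J) _.
rewrite muE; under eq_bigr do rewrite /ball_ cball_volume ?mulr_gt0//.
rewrite sumEFin lee_fin sumr_const card_ord -[leLHS]mulr_natl exprMn.
have -> : d ^+ n = d * d ^+ n.-1 by rewrite -exprS prednK.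
have Jd : J%:R * d <= 2.
  rewrite /J -natr1 mulrDl mul1r (_ : 2 = 1 + 1)// lerD//.
  by rewrite -ler_pdivlMr// mul1r truncn_le invr_ge0 ltW.
have -> : J%:R * (d * d ^+ n.-1 * D ^+ n * omega n) =
  (J%:R * d) * (D ^+ n * omega n * d ^+ n.-1) by ring.
rewrite -2!(mulrA 2) ler_wpM2r// !mulr_ge0 ?exprn_ge0 ?ltW ?omega_gt0//.
Qed.

End cones.

Section sphere_hausdorff.
Context {R : realType} {n : nat}.
Hypothesis n2 : (2 <= n)%N.
Variable r : R.
Hypothesis r0 : 0 < r.
Implicit Types (A F : set 'rV[R]_n).

Let n0 : (0 < n)%N. Proof. exact: leq_trans n2. Qed.
Let m0 : (0 < n.-1)%N. Proof. by rewrite -ltnS prednK. Qed.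

(** Hausdorff measure dominates cone volume, as the cone over each set of a
    cover costs at most a constant times the gauge of that set.  In particular
    it is positive on caps. *)
Lemma cone_le_hausdorff : exists2 C : R, 0 < C &
  forall A, (lebesgue_n (cone r A) <= C%:E * hausdorff n.-1 A)%E.
Proof.
have [mu muE] := @lebesgue_outer_measure R n n0.
pose C1 := 2 * (r^-1 + 1) ^+ n * omega n : R.
have C1_gt0 : 0 < C1.
  by rewrite !mulr_gt0 ?omega_gt0// exprn_gt0// addr_gt0// invr_gt0.
pose C := C1 * 2 ^+ n.-1 / omega n.-1.
have C_gt0 : 0 < C by rewrite divr_gt0 ?omega_gt0// mulr_gt0// exprn_gt0.
exists C => // A; apply: le_trans (_ : _ <= C%:E * hausdorff_delta n.-1 1 A)%E _; last first.
  by apply: lee_wpmul2l; [rewrite lee_fin ltW|exact: hausdorff_delta_le_hausdorff].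
rewrite -lee_pdivrMl//; apply: le_ereal_inf_tmp => _ [F [Fd AF] <-].
rewrite lee_pdivrMl// -nneseriesZl; last by move=> k _; rewrite lee_fin gauge_ge0.
apply: (@le_trans _ _ (\sum_(k <oo) mu (cone r (F k)))%E).
  apply: le_trans (outer_measure_sigma_subadditive mu (fun k => cone r (F k))).
  rewrite muE; apply: le_lebesgue_n => q [qn0 q1 /AF[k _ Fk]].
  by exists k.
apply: lee_nneseries => k _; first by move=> _; exact: outer_measure_ge0.
rewrite muE -EFinM.
have -> : C * (omega n.-1 * (ediam (F k) / 2) ^+ n.-1) = C1 * ediam (F k) ^+ n.-1.
  rewrite /C expr_div_n mulrA divfK ?gt_eqF ?omega_gt0// -mulrA; congr (_ * _).
  by rewrite mulrC divfK// expf_neq0.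
have small := @cone_small_volume R n n0 r r0 (F k).
have [d0|d0] := ltP 0 (ediam (F k)).
  apply: small => //; first by apply: ediam_le => //; exact: Fd.
  by move=> x y Fx Fy; exact: (ediam_ge (Fd k)).
(* A set of diameter 0 has diameter at most [e] for every [e], hence its
   cone has volume at most [C1 * e ^+ n.-1]. *)
have dE : ediam (F k) = 0 by apply/eqP; rewrite eq_le d0 ediam_ge0.
rewrite dE expr0n gtn_eqF// mulr0.
rewrite (@le_small_eq0 _ (lebesgue_n (cone r (F k))) C1)//; first exact: lebesgue_n_ge0.
move=> e e0 e1; apply: le_trans (small e e0 e1 _) _.
  move=> x y Fx Fy; apply: le_trans (ediam_ge (Fd k) Fx Fy) _.
  by rewrite dE ltW.
rewrite lee_fin mulrC -/C1 ler_wpM2r// ?(ltW C1_gt0)//.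
by rewrite -[leRHS]expr1 ler_wiXn2l// ltW.
Qed.

(** Disjoint balls of radius [e] centred on the sphere lie in an annulus of
    width [2 e]. *)
Lemma packing_bound (e : R) (s : seq 'rV[R]_n) : 0 < e -> e < r ->
  (forall x, x \in s -> enorm x = r) ->
  pairwise (fun x y => 2 * e <= enorm (x - y)) s ->
  (size s)%:R * e ^+ n.-1 <= 2 * n%:R * (2 * r) ^+ n.-1.
Proof.
move=> e0 er sr sep.
have [m mE] := @lebesgue_borel_measure R n n0.
pose W (s : seq 'rV[R]_n) := [set y | exists2 x, x \in s & cball x e y] : set (borel R n).
have Wcons x t : W (x :: t) = cball x e `|` W t.
  apply/seteqP; split=> y.
    by case=> z; rewrite inE => /orP[/eqP->|zt] zy; [left|right; exists z].
  by case=> [xy|[z zt zy]]; [exists x; rewrite ?mem_head|exists z; rewrite ?inE ?zt ?orbT].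
have mW t : measurable (W t).
  elim: t => [|x t IH].
    by rewrite (_ : W _ = set0)//; apply/seteqP; split=> // y [].
  by rewrite Wcons; apply: measurableU => //; apply: open_borel; exact: open_cball.
have vol t : pairwise (fun x y => 2 * e <= enorm (x - y)) t ->
    (((size t)%:R * (e ^+ n * omega n))%:E <= m (W t))%E.
  elim: t => [|x t IH]; first by rewrite mul0r measure_ge0.
  rewrite pairwise_cons => /andP[/allP xt /IH {}IH].
  rewrite Wcons measureU//; last 2 first.
  - by apply: open_borel; exact: open_cball.
  - apply/seteqP; split=> // y [xy [z /xt xz zy]].
    have := ler_enormB x y z; rewrite (enormC y z) => h.
    have := le_trans xz h; rewrite leNgt mulr_natl mulr2n.
    by rewrite ltrD.
  rewrite /= mE cball_volume// /= -natr1 mulrDl mul1r addrC EFinD.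
  exact: leeD.
have sub : W s `<=` eball (r + e) `\` eball (r - e).
  move=> y [x /sr xr xy]; rewrite /eball /cball /= in xy *; split.
    have := ler_enormD x (y - x); rewrite addrC subrK xr => /le_lt_trans; apply.
    by rewrite ltrD2l enormC.
  apply/negP; rewrite -leNgt; have := ler_enormD y (x - y).
  rewrite addrC subrK xr => h; rewrite lerBlDr (le_trans h)// lerD2l.
  exact: ltW.
have rme : 0 < r - e by rewrite subr_gt0.
have rpe : r - e <= r + e by rewrite lerBlDr -addrA lerDl addr_ge0// ltW.
have := vol s sep; rewrite mE => /le_trans/(_ (le_lebesgue_n sub)).
rewrite annulus_volume// lee_fin.
rewrite mulrA ler_pM2r ?omega_gt0// => h.
have {}h := le_trans h (exprB_le n (ltW rme) rpe).
rewrite -(ler_pM2r e0) -[leLHS]mulrA -exprSr prednK// (le_trans h)//.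
have -> : r + e - (r - e) = 2 * e by ring.
rewrite [leRHS]mulrC -!mulrA [leRHS]mulrCA ler_pM2l// ler_pM2l// ler_wpM2l//.
apply: lerXn2r; rewrite ?nnegrE.
- by rewrite addr_ge0// ltW.
- by rewrite mulr_ge0// ltW.
- by rewrite mulr_natl mulr2n lerD2l ltW.
Qed.

(** A maximal family of points of the sphere at mutual distances at least
    [2 * e] gives a cover by balls of radius [2 * e]; the packing bound makes
    its cost bounded independently of [e]. *)
Lemma hausdorff_sphere_lty : (hausdorff n.-1 (esphere r : set 'rV[R]_n) < +oo)%E.
Proof.
pose K := 2 * n%:R * (2 * r) ^+ n.-1.
have K0 : 0 <= K by rewrite !mulr_ge0// exprn_ge0// mulr_ge0// ltW.
apply: (@le_lt_trans _ _ (omega n.-1 * 2 ^+ n.-1 * K)%:E); last exact: ltry.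
apply: ge_ereal_sup => _ [d /= d0 <-].
pose e := Num.min (d / 4) (r / 2).
have e0 : 0 < e by rewrite lt_min !divr_gt0.
have ed : 2 * e + 2 * e <= d.
  rewrite (_ : 2 * e + 2 * e = e * 4); last by ring.
  by rewrite -ler_pdivlMr// ge_min lexx.
have er : e < r.
  apply: (@le_lt_trans _ _ (r / 2)); first by rewrite ge_min lexx orbT.
  by rewrite ltr_pdivrMr// mulr_natr mulr2n ltrDl.
have en0 : 0 < e ^+ n.-1 by rewrite exprn_gt0.
pose P k := `[< exists s : seq 'rV[R]_n, [/\ size s = k,
  forall x, x \in s -> enorm x = r &
  pairwise (fun x y => 2 * e <= enorm (x - y)) s] >].
have P0 : exists k, P k by exists 0%N; apply/asboolP; exists [::].
have Pub k : P k -> (k <= Num.truncn (K / e ^+ n.-1))%N.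
  move=> /asboolP[s [<- sr sep]]; rewrite -ltnS -(ltr_nat R).
  apply: le_lt_trans (truncnS_gt _); rewrite ler_pdivlMr//.
  exact: packing_bound.
case: (ex_maxnP P0 Pub) => k /asboolP[s [sk sr sep]] kmax.
pose F j := if (j < size s)%N then cball (nth 0 s j) (2 * e) else set0.
have Fsmall j x y : F j x -> F j y -> enorm (x - y) <= 2 * e + 2 * e.
  rewrite /F; case: ifP => // _; rewrite /cball /= => xj yj.
  apply: le_trans (ler_enormB x (nth 0 s j) y) _.
  by rewrite lerD// ltW// enormC.
apply: (@le_trans _ _ (\sum_(0 <= j <oo) (omega n.-1 * (ediam (F j) / 2) ^+ n.-1)%:E)%E).
  apply: ereal_inf_lbound; exists F => //; split=> [j x y Fx Fy|x xr].
    by apply: le_trans ed; exact: Fsmall Fx Fy.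
  apply: contrapT => nF; have /kmax : P k.+1; last by rewrite ltnn.
  apply/asboolP; exists (x :: s); split; first by rewrite /= sk.
    by move=> y; rewrite inE => /orP[/eqP->|/sr].
  rewrite pairwise_cons sep andbT; apply/allP => y ys.
  rewrite leNgt; apply/negP => xy; apply: nF.
  exists (index y s) => //; rewrite /F index_mem ys nth_index//.
  by rewrite /cball /= enormC.
rewrite (nneseries_split _ (size s)); last by move=> *; rewrite lee_fin gauge_ge0.
rewrite [X in (_ + X)%E]eseries0 ?adde0; last first.
  by move=> j; rewrite add0n => sj _; rewrite /F ltnNge sj gauge_set0.
rewrite add0n sumEFin lee_fin.
apply: (@le_trans _ _ (\sum_(0 <= j < size s) (omega n.-1 * (2 * e) ^+ n.-1))).
  apply: ler_sum => j _; rewrite ler_pM2l ?omega_gt0//.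
  have e2 : 0 <= 2 * e by rewrite mulr_ge0// ltW.
  rewrite lerXn2r ?nnegrE ?divr_ge0 ?ediam_ge0// ler_pdivrMr// mulr_natr mulr2n.
  by apply: ediam_le; [rewrite addr_ge0|exact: Fsmall].
rewrite sumr_const_nat subn0 -[leLHS]mulr_natl exprMn.
have := packing_bound e0 er sr sep; rewrite -/K => h.
have w0 : 0 <= omega n.-1 * 2 ^+ n.-1 :> R by rewrite mulr_ge0// ?exprn_ge0// ltW// omega_gt0.
apply: (le_trans _ (ler_wpM2l w0 h)); rewrite le_eqVlt; apply/orP; left; apply/eqP; ring.
Qed.


End sphere_hausdorff.

Section reflections.
Context {R : realType} {n : nat}.
Implicit Types x y u v w : 'rV[R]_n.

(** The reflection in the hyperplane orthogonal to [x - y] exchanges two vectors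
    of the same length. *)
Lemma exists_reflection x y : enorm x = enorm y ->
  exists T : 'rV[R]_n -> 'rV[R]_n,
    [/\ involutive T, forall u v, enorm (T u - T v) = enorm (u - v),
        forall a u, T (a *: u) = a *: T u & T x = y].
Proof.
move=> xy; pose w := x - y; pose T u := u - (2 * dot u w / dot w w) *: w.
have [w0|w0] := eqVneq w 0.
  by exists id; split=> //; apply/eqP; rewrite -subr_eq0 -/w w0.
have ww0 : dot w w != 0 by rewrite -enorm_sqr sqrf_eq0 enorm_eq0.
have dx : 2 * dot x w = dot w w.
  by rewrite /w !dotE (dotC y x) -!enorm_sqr xy; ring.
have xw : x - w = y by rewrite /w opprB addrC subrK.
clearbody w.
have Tsub u v : T u - T v = T (u - v).
  by rewrite /T dotDl dotNl; apply/rowP => i; rewrite !mxE; ring.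
exists T; split=> [u|u v|a u|].
- rewrite /T dotDl dotNl dotZl; apply/rowP => i; rewrite !mxE; field; exact: ww0.
- rewrite Tsub /enorm; congr (Num.sqrt _); rewrite /T; move: (u - v) => z.
  rewrite !dotE (dotC w z); field; exact: ww0.
- by rewrite /T dotZl; apply/rowP => i; rewrite !mxE; ring.
- by rewrite /T dx divff// scale1r.
Qed.

End reflections.

Section cone_measure.
Context {R : realType} {n : nat}.
Hypothesis n2 : (2 <= n)%N.
Variable r : R.
Hypothesis r0 : 0 < r.
Local Notation B := (borel R n).
Local Notation S := (esphere r : set 'rV[R]_n).

Let n0 : (0 < n)%N. Proof. exact: leq_trans n2. Qed.
Let m0 : (0 < n.-1)%N. Proof. by rewrite -ltnS prednK. Qed.

Lemma measurable_proj : measurable_fun setT (proj_sphere r : B -> B).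
Proof.
apply: measurable_borel => i.
rewrite (_ : (fun _ => _) = (fun x : B => r * (enorm x `^ (-1)) * x ord0 i)).
  apply: measurable_funM; last exact: measurable_coord.
  apply: measurable_funM => //.
  by apply: (measurableT_comp (measurable_powR _)); exact: measurable_enorm.
by apply/funext => x; rewrite !mxE powR_inv1// enorm_ge0.
Qed.

Lemma tcone_preimage (t : R) (E : set 'rV[R]_n) :
  tcone t r E = proj_sphere r @^-1` E `&` (eball t `\` esphere 0).
Proof.
apply/seteqP; split=> q.
  by case=> qn0 qt Eq; split=> //; split=> //; apply/eqP; rewrite enorm_eq0.
by case=> Eq [qt /eqP]; rewrite enorm_eq0.
Qed.

Lemma measurable_tcone (t : R) (E : set B) : measurable E ->
  measurable (tcone t r E : set B).
Proof.
move=> mE; rewrite tcone_preimage; apply: measurableI.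
  by rewrite -[X in measurable X]setTI; exact: measurable_proj.
by apply: measurableD; [exact: measurable_eball|exact: measurable_esphere].
Qed.

(** The cone over a cap around [x] contains a ball around the midpoint between
    the origin and the point of the unit sphere in the direction of [x]. *)
Lemma cone_cball_gt0 x (rho : R) : S x -> 0 < rho ->
  (0 < lebesgue_n (cone r (cball x rho)))%E.
Proof.
move=> Sx rho0; pose h := Num.min (1 / 4) (rho / (16 * r)).
have h0 : 0 < h by rewrite lt_min !divr_gt0// mulr_gt0.
have h4 : h <= 1 / 4 by rewrite ge_min lexx.
have hr : h * (16 * r) <= rho by rewrite -ler_pdivlMr ?mulr_gt0// ge_min lexx orbT.
pose c := (2 * r)^-1 *: x.
have cE : enorm c = 1 / 2.
  rewrite enormZ Sx gtr0_norm ?invr_gt0 ?mulr_gt0// invfM -mulrA mulVf ?gt_eqF//.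
  by rewrite mulr1 mul1r.
apply: (@lt_le_trans _ _ (lebesgue_n (cball c h))).
  by rewrite cball_volume// lte_fin mulr_gt0 ?exprn_gt0 ?omega_gt0.
apply: le_lebesgue_n => q cq; rewrite /cball /= in cq.
have q1 : 1 / 4 < enorm q.
  have := ler_enormD (c - q) q; rewrite subrK cE; lra.
have q2 : enorm q < 3 / 4.
  have := ler_enormD (q - c) c; rewrite subrK cE enormC; lra.
have q0 : 0 < enorm q by lra.
split; [by rewrite -enorm_gt0|by lra|].
rewrite /cball /=.
have -> : x - proj_sphere r q =
    (r / enorm q) *: ((c - q) + (enorm q - 1 / 2) *: (r^-1 *: x)).
  rewrite /proj_sphere /c scalerDr scalerBr !scalerA addrAC -scalerDl.
  rewrite [X in X *: x](_ : _ = 1) ?scale1r//.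
  by field; rewrite !gt_eqF.
rewrite enormZ gtr0_norm ?divr_gt0//.
have xr : enorm (r^-1 *: x) = 1.
  by rewrite enormZ Sx gtr0_norm ?invr_gt0// mulVf// gt_eqF.
have hq : `|enorm q - 1 / 2| < h.
  rewrite -cE ltr_norml ltrNl opprB.
  have := ler_enormD (c - q) q; have := ler_enormD (q - c) c.
  rewrite !subrK (enormC q c) => h1 h2; apply/andP; split; lra.
have hs : enorm ((c - q) + (enorm q - 1 / 2) *: (r^-1 *: x)) < 2 * h.
  apply: le_lt_trans (ler_enormD _ _) _; rewrite enormZ xr mulr1; lra.
rewrite mulrAC ltr_pdivrMr//.
have : r * enorm ((c - q) + (enorm q - 1 / 2) *: (r^-1 *: x)) < r * (2 * h) by rewrite ltr_pM2l.
have : rho * (1 / 4) < rho * enorm q by rewrite ltr_pM2l.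
lra.
Qed.

(** The cone over a part of the sphere has volume proportional to its surface
    measure, as reflections act transitively on the sphere and preserve both. *)
Theorem cone_volume_hausdorff : exists2 c : R, 0 < c &
  forall E : set B, measurable E ->
    lebesgue_n (cone r E) = (c%:E * hausdorff n.-1 (E `&` S))%E.
Proof.
have [L LE] := @lebesgue_borel_measure R n n0.
have [H HE] := @hausdorff_borel_measure R n n.-1 m0.
have mD : measurable (eball 1 `\` esphere 0 : set B).
  by apply: measurableD; [exact: measurable_eball|exact: measurable_esphere].
have [LD LDE] := restricted_measure L mD.
have [m1 m1E'] := image_measure LD measurable_proj.
have mS := @measurable_esphere R n r.
have [m2 m2E'] := restricted_measure H mS.
have m1E E : m1 E = lebesgue_n (cone r E) by rewrite m1E' LDE LE tcone_preimage.
have m2E E : m2 E = hausdorff n.-1 (E `&` S) by rewrite m2E' HE.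
have m1S : m1 S = (omega n)%:E by rewrite m1E cone_full_volume.
have m2S : m2 S = hausdorff n.-1 S by rewrite m2E setIid.
have p1 x rho : S x -> 0 < rho -> (0 < m1 (cball x rho))%E.
  by move=> Sx rho0; rewrite m1E cone_cball_gt0.
have [C C0 CH] := cone_le_hausdorff n2 r0.
have p2 x rho : S x -> 0 < rho -> (0 < m2 (cball x rho))%E.
  move=> Sx rho0; rewrite m2E -(@pmule_rgt0 _ C%:E) ?lte_fin//.
  apply: lt_le_trans (CH _).
  by rewrite cone_sphere// cone_cball_gt0.
have T0 (T : 'rV[R]_n -> 'rV[R]_n) : (forall a u, T (a *: u) = a *: T u) -> T 0 = 0.
  by move=> h; rewrite -(scale0r (0 : 'rV[R]_n)) h !scale0r.
have Tnorm (T : 'rV[R]_n -> 'rV[R]_n) : (forall a u, T (a *: u) = a *: T u) ->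
    (forall u v, enorm (T u - T v) = enorm (u - v)) -> forall u, enorm (T u) = enorm u.
  by move=> /T0 h Tiso u; rewrite -[T u]subr0 -{1}h Tiso subr0.
have Tball (T : 'rV[R]_n -> 'rV[R]_n) x rho : involutive T ->
    (forall u v, enorm (T u - T v) = enorm (u - v)) ->
    T @^-1` cball x rho = cball (T x) rho.
  by move=> TT Tiso; apply/seteqP; split=> y; rewrite /cball /= -Tiso TT.
have u1 : uniform_on S m1.
  split=> [E mE|x y rho Sx Sy rho0]; first by rewrite !m1E cone_sphere.
  have [T [TT Tiso Tlin Txy]] := exists_reflection (etrans Sx (esym Sy)).
  rewrite !m1E -Txy -Tball// -(@lebesgue_involution _ _ T (cone r (cball x rho)))//.
    congr lebesgue_n; apply/seteqP; split=> q; rewrite /tcone /= /proj_sphere;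
      rewrite Tlin (Tnorm T)// -!enorm_gt0 ?(Tnorm T)//.
  by apply: measurable_tcone; apply: open_borel; exact: open_cball.
have u2 : uniform_on S m2.
  split=> [E mE|x y rho Sx Sy rho0]; first by rewrite !m2E -setIA setIid.
  have [T [TT Tiso Tlin Txy]] := exists_reflection (etrans Sx (esym Sy)).
  rewrite !m2E -Txy -Tball// -(@hausdorff_involution _ _ _ T (cball x rho `&` S))//.
  congr hausdorff; apply/seteqP; split=> q; rewrite /= /esphere /=;
    by rewrite (Tnorm T).
have m1oo : (m1 setT < +oo)%E.
  by rewrite u1.1// setTI m1S ltry.
have m2oo : (m2 setT < +oo)%E.
  by rewrite u2.1// setTI m2S hausdorff_sphere_lty.
have hS0 : (0 < m2 S)%E.
  rewrite m2S -(@pmule_rgt0 _ C%:E) ?lte_fin//; apply: lt_le_trans (CH _).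
  by rewrite cone_full_volume// lte_fin omega_gt0.
have hE : m2 S = (fine (m2 S))%:E.
  by rewrite fineK// ge0_fin_numE// m2S hausdorff_sphere_lty.
have h0 : 0 < fine (m2 S) by rewrite -lte_fin -hE.
exists (omega n / fine (m2 S)); first by rewrite divr_gt0// omega_gt0.
move=> E mE; have := uniform_unique mS m1oo m2oo u1 u2 p1 p2 mE.
rewrite m1S hE -m1E -m2E => eqE.
rewrite mulrC EFinM -muleA eqE muleA -EFinM mulVf ?mul1e// gt_eqF//.
Qed.

End cone_measure.

(** * Radial convex functions with a piecewise affine profile *)

Section radial_subdifferential.
Context {R : realType} {n : nat}.
Variable phi : R -> R.
Implicit Types (x y q : 'rV[R]_n).

Definition subgradient1 (rho t : R) :=
  forall rho', 0 <= rho' -> rho' < 1 -> phi rho + t * (rho' - rho) <= phi rho'.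

Let u x := phi (enorm x).

(** Comparing [x] with the vector of the same length in the direction of [q]
    puts [q] into the equality case of the Cauchy-Schwarz inequality; comparing
    it with the multiples of [x] gives the one-dimensional condition. *)
Lemma radial_subdifferentialP x q : x != 0 -> enorm x < 1 ->
  subdifferential (eball 1) u x q ->
  q = (enorm q / enorm x) *: x /\ subgradient1 (enorm x) (enorm q).
Proof.
rewrite -enorm_gt0 => x0 x1 dq.
have qE : q = (enorm q / enorm x) *: x.
  have [->|] := eqVneq q 0; first by rewrite enorm0 mul0r scale0r.
  rewrite -enorm_gt0 => q0; pose y := (enorm x / enorm q) *: q.
  have yx : enorm y = enorm x by rewrite enormZ gtr0_norm ?divr_gt0// divfK ?gt_eqF.
  have := dq y; rewrite /eball /= yx /u yx => /(_ x1).
  rewrite gerDl dotDr dotNr dotZr -enorm_sqr subr_le0 => h.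
  have /cauchy_schwarz_eq e : enorm q * enorm x <= dot q x.
    by apply: le_trans h; rewrite expr2 mulrA divfK ?gt_eqF// mulrC.
  by rewrite mulrC -scalerA -e scalerA mulVf ?gt_eqF// scale1r.
split=> // rho' rho'0 rho'1; pose y := (rho' / enorm x) *: x.
have yE : enorm y = rho'.
  by rewrite enormZ ger0_norm ?divr_ge0 ?enorm_ge0// divfK ?gt_eqF.
have := dq y; rewrite /eball /= yE /u yE => /(_ rho'1); apply: le_trans.
rewrite lerD2l dotDr dotNr dotZr {2 3}qE !dotZl -enorm_sqr le_eqVlt; apply/orP; left.
by apply/eqP; field; rewrite gt_eqF.
Qed.

Lemma radial_subdifferential x q : x != 0 ->
  q = (enorm q / enorm x) *: x -> subgradient1 (enorm x) (enorm q) ->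
  subdifferential (eball 1) u x q.
Proof.
rewrite -enorm_gt0 => x0 qE sub y y1; apply: le_trans (sub _ (enorm_ge0 y) y1).
rewrite lerD2l dotDr dotNr mulrBr.
have -> : dot q x = enorm q * enorm x.
  rewrite {1}qE dotZl -enorm_sqr; field; exact: lt0r_neq0.
by rewrite lerD2r cauchy_schwarz.
Qed.

End radial_subdifferential.

Section profile.
Context {R : realType}.
Variables r1 r2 s1 s2 : R.
Hypotheses (r1_gt0 : 0 < r1) (r12 : r1 < r2) (r2_lt1 : r2 < 1).
Hypotheses (s1_gt0 : 0 < s1) (s12 : s1 < s2).

(** The absolute values of the profile at [r2] and at [r1], computed inwards from
    its value 0 at the boundary. *)
Definition height2 (r2 s2 : R) := s2 * (1 - r2).
Definition height1 (r1 r2 s1 s2 : R) := height2 r2 s2 + s1 * (r2 - r1).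

Definition profile (r1 r2 s1 s2 t : R) := Num.max (- height1 r1 r2 s1 s2)
  (Num.max (s1 * (t - r2) - height2 r2 s2) (s2 * (t - 1))).

Local Notation h1 := (height1 r1 r2 s1 s2).
Local Notation h2 := (height2 r2 s2).
Local Notation phi := (profile r1 r2 s1 s2).

Let mul_sub_ge0 (k a b : R) : 0 <= k -> a <= b -> 0 <= k * (b - a).
Proof. by move=> k0 ab; rewrite mulr_ge0// subr_ge0. Qed.

Let s1_ge0 : 0 <= s1. Proof. exact: ltW. Qed.
Let s21_ge0 : 0 <= s2 - s1. Proof. by rewrite subr_ge0 ltW. Qed.

Lemma height2_gt0 : 0 < h2.
Proof. by rewrite mulr_gt0 ?subr_gt0// (lt_trans s1_gt0). Qed.

Lemma height1_gt0 : 0 < h1.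
Proof. by rewrite addr_gt0 ?height2_gt0// mulr_gt0 ?subr_gt0. Qed.

Lemma profile_inner t : t <= r1 -> phi t = - h1.
Proof.
move=> tr; rewrite /profile /height1 /height2; apply/max_idPl.
have p1 := mul_sub_ge0 s1_ge0 tr.
have p2 := mul_sub_ge0 s21_ge0 (le_trans tr (ltW r12)).
by rewrite ge_max; apply/andP; split; lra.
Qed.

Lemma profile_middle t : r1 <= t -> t <= r2 -> phi t = s1 * (t - r2) - h2.
Proof.
move=> rt tr; rewrite /profile /height1 /height2.
have p1 := mul_sub_ge0 s1_ge0 rt; have p2 := mul_sub_ge0 s21_ge0 tr.
rewrite (max_idPl (_ : s2 * (t - 1) <= s1 * (t - r2) - s2 * (1 - r2))); last by lra.
by apply/max_idPr; lra.
Qed.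

Lemma profile_outer t : r2 <= t -> phi t = s2 * (t - 1).
Proof.
move=> rt; rewrite /profile /height1 /height2.
have p1 := mul_sub_ge0 s1_ge0 (le_trans (ltW r12) rt).
have p2 := mul_sub_ge0 s21_ge0 rt.
rewrite (max_idPr (_ : s1 * (t - r2) - s2 * (1 - r2) <= s2 * (t - 1))); last by lra.
by apply/max_idPr; lra.
Qed.

Lemma profile_ge t : [/\ - h1 <= phi t, s1 * (t - r2) - h2 <= phi t &
  s2 * (t - 1) <= phi t].
Proof. by rewrite /profile; split; rewrite !le_max lexx ?orbT. Qed.

Lemma profile_convex t a b c : 0 <= t <= 1 -> c <= t * a + (1 - t) * b ->
  phi c <= t * phi a + (1 - t) * phi b.
Proof.
move=> /andP[t0 t1] cab.
have [a1 a2 a3] := profile_ge a; have [b1 b2 b3] := profile_ge b.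
have t1' : 0 <= 1 - t by rewrite subr_ge0.
have conv l u v k : 0 <= k -> k * (a - u) - v <= phi a -> k * (b - u) - v <= phi b ->
    l = k * (c - u) - v -> l <= t * phi a + (1 - t) * phi b.
  move=> k0 la lb ->.
  have ha := ler_wpM2l t0 la; have hb := ler_wpM2l t1' lb.
  have hc := ler_wpM2l k0 cab; lra.
rewrite {1}/profile !ge_max; apply/and3P; split.
- by apply: (conv _ 0 h1 0); rewrite ?mul0r ?sub0r.
- exact: (conv _ r2 h2 s1) (ltW s1_gt0) _ _ _.
- by apply: (conv _ 1 0 s2); rewrite ?subr0// ltW// (lt_trans s1_gt0).
Qed.

Lemma profile_lipschitz a b : phi a <= phi b + s2 * `|a - b|.
Proof.
have [b1 b2 b3] := profile_ge b.
have s2_gt0 : 0 < s2 by exact: lt_trans s12.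
have ab := ler_norm (a - b); have ab0 := normr_ge0 (a - b).
have h k : 0 <= k -> k <= s2 -> k * (a - b) <= s2 * `|a - b|.
  move=> k0 ks; apply: le_trans (ler_wpM2l k0 ab) _; exact: ler_wpM2r.
have hs1 := h _ (ltW s1_gt0) (ltW s12); have hs2 := h _ (ltW s2_gt0) (lexx _).
have h0 := mulr_ge0 (ltW s2_gt0) ab0.
by rewrite {1}/profile !ge_max; apply/and3P; split; lra.
Qed.

Lemma subgradient_inner rho t : 0 <= t -> 0 <= rho -> rho < r1 ->
  subgradient1 phi rho t -> t = 0.
Proof.
move=> t0 rho0 rhor sub; have := sub r1 (ltW r1_gt0) (lt_trans r12 r2_lt1).
rewrite !profile_inner//; last exact: ltW.
rewrite gerDl => h; apply/eqP; rewrite eq_le t0 andbT.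
by rewrite -(pmulr_lle0 t (_ : 0 < r1 - rho)) ?subr_gt0.
Qed.

Lemma subgradient_r1 t : subgradient1 phi r1 t -> t <= s1.
Proof.
move=> sub; have := sub r2 (ltW (lt_trans r1_gt0 r12)) r2_lt1.
rewrite (profile_inner (lexx _)) (profile_outer (lexx _)) /height1 /height2 => h.
by rewrite -(ler_pM2r (_ : 0 < r2 - r1)) ?subr_gt0//; lra.
Qed.

Lemma subgradient_middle rho t : r1 < rho -> rho < r2 ->
  subgradient1 phi rho t -> t = s1.
Proof.
move=> r1rho rhor2 sub.
have := sub r2 (ltW (lt_trans r1_gt0 r12)) r2_lt1.
have := sub r1 (ltW r1_gt0) (lt_trans r12 r2_lt1).
rewrite (profile_middle (lexx r1) (ltW r12)) (profile_middle (ltW r12) (lexx r2)).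
rewrite (profile_middle (ltW r1rho) (ltW rhor2)) => ha hb.
apply/eqP; rewrite eq_le; apply/andP; split.
  by rewrite -(ler_pM2r (_ : 0 < r2 - rho)) ?subr_gt0//; lra.
by rewrite -(ler_pM2r (_ : 0 < rho - r1)) ?subr_gt0//; lra.
Qed.

Lemma subgradient_r2 t : subgradient1 phi r2 t -> s1 <= t <= s2.
Proof.
move=> sub; have := sub r1 (ltW r1_gt0) (lt_trans r12 r2_lt1).
have r2_gt0 : 0 < r2 by exact: lt_trans r12.
pose m := (r2 + 1) / 2; have mr : r2 < m by rewrite /m midf_lt.
have m1 : m < 1 by rewrite /m midf_lt.
have := sub m (ltW (lt_trans r2_gt0 mr)) m1.
rewrite (profile_outer (lexx _)) (profile_outer (ltW mr)) (profile_inner (lexx _)).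
rewrite /height1 /height2 => ha hb; apply/andP; split.
  by rewrite -(ler_pM2r (_ : 0 < r2 - r1)) ?subr_gt0//; lra.
by rewrite -(ler_pM2r (_ : 0 < m - r2)) ?subr_gt0//; lra.
Qed.

Lemma subgradient_outer rho t : r2 < rho -> rho < 1 ->
  subgradient1 phi rho t -> t = s2.
Proof.
move=> r2rho rho1 sub; have r2_gt0 : 0 < r2 by exact: lt_trans r12.
pose m := (rho + 1) / 2; have mr : rho < m by rewrite /m midf_lt.
have m1 : m < 1 by rewrite /m midf_lt.
have := sub r2 (ltW r2_gt0) r2_lt1.
have := sub m (ltW (lt_trans (lt_trans r2_gt0 r2rho) mr)) m1.
rewrite (profile_outer (lexx r2)) (profile_outer (ltW r2rho)).
rewrite (profile_outer (ltW (lt_trans r2rho mr))) => ha hb.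
apply/eqP; rewrite eq_le; apply/andP; split.
  by rewrite -(ler_pM2r (_ : 0 < m - rho)) ?subr_gt0//; lra.
by rewrite -(ler_pM2r (_ : 0 < rho - r2)) ?subr_gt0//; lra.
Qed.

Lemma subgradient_at_r1 t : 0 <= t -> t <= s1 -> subgradient1 phi r1 t.
Proof.
move=> t0 ts rho rho0 rho1; rewrite (profile_inner (lexx _)).
have [a1 a2 a3] := profile_ge rho; have [rr|/ltW rr] := leP rho r1.
  by have := mul_sub_ge0 t0 rr; lra.
have st : 0 <= s1 - t by rewrite subr_ge0.
by apply: le_trans a2; rewrite /height1; have := mul_sub_ge0 st rr; lra.
Qed.

Lemma subgradient_at_r2 t : s1 <= t -> t <= s2 -> subgradient1 phi r2 t.
Proof.
move=> st ts rho rho0 rho1; rewrite (profile_outer (lexx _)).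
have [a1 a2 a3] := profile_ge rho; have [rr|/ltW rr] := leP rho r2.
  have st' : 0 <= t - s1 by rewrite subr_ge0.
  by apply: le_trans a2; rewrite /height2; have := mul_sub_ge0 st' rr; lra.
have ts' : 0 <= s2 - t by rewrite subr_ge0.
by apply: le_trans a3; have := mul_sub_ge0 ts' rr; lra.
Qed.

End profile.

Section truncated_cones.
Context {R : realType} {n : nat}.
Hypothesis n0 : (0 < n)%N.
Local Notation B := (borel R n).

Lemma proj_sphereZ (r a : R) (q : 'rV[R]_n) : 0 < a ->
  proj_sphere r (a *: q) = proj_sphere r q.
Proof.
move=> a0; rewrite /proj_sphere enormZ gtr0_norm// scalerA invfM.
by rewrite (mulrC a^-1) mulrA divfK ?gt_eqF.
Qed.

Lemma tconeE (s r : R) (E : set 'rV[R]_n) : 0 < s ->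
  affine s 0 @^-1` tcone s r E = cone r E.
Proof.
move=> s0; apply/seteqP; split=> q; rewrite /tcone /affine /= addr0;
  by rewrite scaler_eq0 gt_eqF//= enormZ gtr0_norm// gtr_pMr// proj_sphereZ.
Qed.

Lemma tcone_volume (s r : R) (E : set 'rV[R]_n) : 0 < s ->
  lebesgue_n (tcone s r E) = ((s ^+ n)%:E * lebesgue_n (cone r E))%E.
Proof. by move=> s0; rewrite (lebesgue_affine 0 _ s0) tconeE. Qed.

Lemma shell_volume (s s' r : R) (E : set B) : measurable E -> 0 < s -> s < s' ->
  lebesgue_n (tcone s' r E `\` tcone s r E : set 'rV[R]_n) =
    ((s' ^+ n - s ^+ n)%:E * lebesgue_n (cone r E))%E.
Proof.
move=> mE s_gt0 ss'; have s'_gt0 := lt_trans s_gt0 ss'.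
have [m m_E] := @lebesgue_borel_measure R n n0.
have fin t : 0 < t -> lebesgue_n (tcone t r E) \is a fin_num.
  move=> t0; rewrite ge0_fin_numE ?lebesgue_n_ge0//.
  apply: (@le_lt_trans _ _ (lebesgue_n (eball t : set 'rV[R]_n))).
    by apply: le_lebesgue_n => q [].
  by rewrite eball_volume// ltry.
rewrite -m_E measureD; [|exact: measurable_tcone..|]; last first.
  by rewrite /= m_E ltey_eq fin.
rewrite /= !m_E setIidr; last first.
  by move=> q [qn0 qs Eq]; split=> //; exact: lt_trans ss'.
rewrite (tcone_volume _ _ s'_gt0) (tcone_volume _ _ s_gt0).
have := fin 1 ltr01; rewrite tcone_volume// expr1n mul1e => /fineK <-.
by rewrite -!EFinM -EFinB -mulrBl.
Qed.

End truncated_cones.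

Section radial_monge_ampere.
Context {R : realType} {n : nat}.
Hypothesis n0 : (0 < n)%N.
Local Notation B := (borel R n).
Variables r1 r2 s1 s2 : R.
Hypotheses (r1_gt0 : 0 < r1) (r12 : r1 < r2) (r2_lt1 : r2 < 1).
Hypotheses (s1_gt0 : 0 < s1) (s12 : s1 < s2).

Local Notation h1 := (height1 r1 r2 s1 s2).
Local Notation h2 := (height2 r2 s2).
Local Notation phi := (profile r1 r2 s1 s2).
Let u (x : 'rV[R]_n) := phi (enorm x).
Let r2_gt0 : 0 < r2. Proof. exact: lt_trans r12. Qed.
Let r1_lt1 : r1 < 1. Proof. exact: lt_trans r2_lt1. Qed.
Let s2_gt0 : 0 < s2. Proof. exact: lt_trans s12. Qed.

Let proj_eq (rho : R) (q : 'rV[R]_n) : 0 < rho -> q != 0 ->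
  q = (enorm q / enorm (proj_sphere rho q)) *: proj_sphere rho q.
Proof.
move=> rho0 qn0; rewrite enorm_proj// /proj_sphere scalerA.
move: qn0; rewrite -enorm_gt0 => q0.
rewrite [X in X *: _](_ : _ = 1) ?scale1r//; field.
by rewrite !gt_eqF.
Qed.

Lemma monge_ampere_lower (E : set 'rV[R]_n) :
  tcone s1 r1 E `|` ((tcone s2 r2 E `\` tcone s1 r2 E) `\` esphere s1) `<=`
  \bigcup_(x in E) subdifferential (eball 1) u x.
Proof.
have proj_neq0 (rho : R) (q : 'rV[R]_n) : 0 < rho -> q != 0 -> proj_sphere rho q != 0.
  by move=> rho0 qn0; rewrite -enorm_gt0 enorm_proj.
move=> q [[qn0 qs Eq]|[[[qn0 qs Eq] qs1] /eqP qS]].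
  exists (proj_sphere r1 q) => //; apply: radial_subdifferential.
  - exact: proj_neq0.
  - exact: proj_eq.
  - by rewrite enorm_proj//; apply: subgradient_at_r1 => //; [exact: enorm_ge0|exact: ltW].
exists (proj_sphere r2 q) => //; apply: radial_subdifferential.
- exact: proj_neq0.
- exact: proj_eq.
- rewrite enorm_proj//; apply: subgradient_at_r2 => //; last exact: ltW.
  by rewrite leNgt; apply/negP => qs1'; apply: qs1; split.
Qed.

(** Where the slope is constant the subdifferential consists of one vector of
    norm 0, [s1] or [s2]; the remaining vectors belong to points of the two
    spheres. *)
Lemma monge_ampere_upper (E : set 'rV[R]_n) : E `<=` eball 1 ->
  \bigcup_(x in E) subdifferential (eball 1) u x `<=`
  (tcone s1 r1 E `|` (tcone s2 r2 E `\` tcone s1 r2 E)) `|`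
  ([set 0] `|` (esphere s1 `|` esphere s2)).
Proof.
move=> E1 q [x Ex dq]; have x1 := E1 _ Ex.
have [q0|qn0] := eqVneq q 0; first by right; left.
have [qs1|qs1] := eqVneq (enorm q) s1; first by right; right; left.
have [qs2|qs2] := eqVneq (enorm q) s2; first by right; right; right.
have q_gt0 : 0 < enorm q by rewrite enorm_gt0.
have xn0 : x != 0.
  apply/eqP => x0; move: dq; rewrite x0 => /(_ ((r1 / enorm q) *: q)).
  have yE : enorm ((r1 / enorm q) *: q) = r1.
    by rewrite enormZ gtr0_norm ?divr_gt0// divfK ?gt_eqF.
  rewrite /eball /= yE => /(_ r1_lt1).
  rewrite /u yE enorm0 !profile_inner//; last exact: ltW.
  rewrite gerDl subr0 dotZr -enorm_sqr expr2 mulrA divfK ?gt_eqF// leNgt.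
  by rewrite mulr_gt0.
have [qE sub] := radial_subdifferentialP xn0 x1 dq.
have x_gt0 : 0 < enorm x by rewrite enorm_gt0.
have projE rho : enorm x = rho -> proj_sphere rho q = x.
  move=> <-; rewrite /proj_sphere {2}qE scalerA mulrA divfK ?gt_eqF//.
  by rewrite divff ?gt_eqF// scale1r.
left; have [xr|xr|xr] := ltgtP (enorm x) r1.
- have := subgradient_inner r1_gt0 r12 r2_lt1 s1_gt0 s12 (enorm_ge0 q) (enorm_ge0 x) xr sub.
  by move=> e; rewrite e ltxx in q_gt0.
- have [xr2|xr2|xr2] := ltgtP (enorm x) r2.
  + have := subgradient_middle r1_gt0 r12 r2_lt1 s1_gt0 s12 xr xr2 sub.
    by move=> e; rewrite e eqxx in qs1.
  + have := subgradient_outer r1_gt0 r12 r2_lt1 s1_gt0 s12 xr2 x1 sub.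
    by move=> e; rewrite e eqxx in qs2.
  + move: sub; rewrite xr2 => /(subgradient_r2 r1_gt0 r12 r2_lt1 s1_gt0 s12)/andP[l1 l2].
    right; split; first by split=> //; [rewrite lt_neqAle qs2|rewrite projE].
    by case=> _; rewrite ltNge l1.
- move: sub; rewrite xr => /(subgradient_r1 r1_gt0 r12 r2_lt1 s1_gt0 s12) l1.
  by left; split=> //; [rewrite lt_neqAle qs1|rewrite projE].
Qed.

Lemma monge_ampere_radial (E : set B) : measurable E -> E `<=` eball 1 ->
  monge_ampere (eball 1) u E =
    ((s1 ^+ n)%:E * lebesgue_n (cone r1 E) +
     (s2 ^+ n - s1 ^+ n)%:E * lebesgue_n (cone r2 E))%E.
Proof.
move=> mE E1; have [m m_E] := @lebesgue_borel_measure R n n0.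
pose C1 : set B := tcone s1 r1 E; pose C2 : set B := tcone s2 r2 E `\` tcone s1 r2 E.
pose S1 : set B := esphere s1; pose S2 : set B := esphere s2.
have mC1 : measurable C1 by exact: measurable_tcone.
have mC2 : measurable C2 by apply: measurableD; exact: measurable_tcone.
have S1_null : m S1 = 0%E by rewrite m_E sphere_null.
have S2_null : m S2 = 0%E by rewrite m_E sphere_null.
have O_null : m [set 0] = 0%E by rewrite m_E origin_null.
have vol : (m (C1 `|` C2) = (s1 ^+ n)%:E * lebesgue_n (cone r1 E) +
     (s2 ^+ n - s1 ^+ n)%:E * lebesgue_n (cone r2 E))%E.
  rewrite measureU//; last first.
    apply/seteqP; split=> // q [[qn0 qs _] [[_ _ Eq] nq]].
    by apply: nq; split.
  by rewrite /= !m_E (tcone_volume _ _ s1_gt0) shell_volume.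
have [mu muE] := @lebesgue_outer_measure R n n0.
rewrite /monge_ampere -vol m_E; apply/eqP; rewrite eq_le; apply/andP; split.
  apply: le_trans (le_lebesgue_n (monge_ampere_upper E1)) _.
  rewrite -muE; apply: le_trans (outer_measureU2 mu _ _) _; rewrite muE.
  rewrite -[leRHS]adde0 leeD2l// -muE; apply: le_trans (outer_measureU2 mu _ _) _.
  apply: le_trans (leeD2l _ (outer_measureU2 mu _ _)) _.
  by rewrite muE -!m_E -/S1 -/S2 O_null S1_null S2_null !add0e.
apply: le_trans (_ : _ <= mu ((C1 `|` (C2 `\` S1)) `|` S1))%E _.
  rewrite -muE; apply: le_outer_measure => q [|qC2]; first by left; left.
  by have [qS1|qS1] := pselect (S1 q); [right|left; right].
apply: le_trans (outer_measureU2 mu _ _) _; rewrite muE -[X in (_ + X)%E]m_E S1_null adde0.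
exact: le_lebesgue_n (@monge_ampere_lower E).
Qed.

End radial_monge_ampere.

Section two_sphere_measures.
Context {R : realType} {n : nat}.
Local Notation B := (borel R n).
Variables (r1 r2 : R).
Hypothesis r12 : r1 < r2.
Local Notation S1 := (esphere r1 : set B).
Local Notation S2 := (esphere r2 : set B).

Lemma esphere_disjoint (E : set B) : (E `\` S1) `&` S2 = E `&` S2.
Proof.
apply/seteqP; split=> x [Ex Sx]; first by split=> //; case: Ex.
split=> //; split=> // S1x; move: r12.
by rewrite -(_ : enorm x = r1)// -(_ : enorm x = r2)// ltxx.
Qed.

Lemma integral_two_spheres (nu : {measure set B -> \bar R}) (f : B -> \bar R)
    (a1 a2 : R) (E : set B) : measurable E -> measurable_fun setT f ->
  (forall x, 0 <= f x)%E -> nu (E `\` S1 `\` S2) = 0%E ->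
  (forall x, S1 x -> f x = a1%:E) -> (forall x, S2 x -> f x = a2%:E) ->
  (\int[nu]_(x in E) f x = a1%:E * nu (E `&` S1) + a2%:E * nu (E `&` S2))%E.
Proof.
move=> mE mf f0 nu0 f1 f2.
have mS1 : measurable S1 by exact: measurable_esphere.
have mS2 : measurable S2 by exact: measurable_esphere.
have cut (A S : set B) (a : R) : measurable A -> measurable S ->
    (forall x, S x -> f x = a%:E) ->
    (\int[nu]_(x in A) f x = a%:E * nu (A `&` S) + \int[nu]_(x in A `\` S) f x)%E.
  move=> mA mS fS; rewrite -{1}(setUIDK A S) ge0_integral_setU//; last 4 first.
  - exact: measurableI.
  - exact: measurableD.
  - exact: measurable_funTS.
  - by apply/eqP/seteqP; split=> // x [[_ Sx] [_ /(_ Sx)]].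
  rewrite -integral_cst; last exact: measurableI.
  by congr (_ + _)%E; apply: eq_integral => x; rewrite inE => -[_ /fS].
rewrite (cut E S1 a1)// (cut (E `\` S1) S2 a2)//; last exact: measurableD.
rewrite esphere_disjoint null_set_integral ?adde0//.
- by apply: measurableD => //; exact: measurableD.
- exact: measurable_funTS.
Qed.

End two_sphere_measures.

Section radial_solution.
Context {R : realType} {n : nat}.
Hypothesis n2 : (2 <= n)%N.
Local Notation B := (borel R n).
Variables r1 r2 s1 s2 p : R.
Hypotheses (r1_gt0 : 0 < r1) (r12 : r1 < r2) (r2_lt1 : r2 < 1).
Hypotheses (s1_gt0 : 0 < s1) (s12 : s1 < s2).
Variables (A1 A2 c1 c2 : R) (nu : {measure set B -> \bar R}).
Hypothesis nuE : forall E : set B, measurable E ->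
  nu E = (A1%:E * sigma r1 E + A2%:E * sigma r2 E)%E.

(** The surface area of the sphere of radius [r], by which [sigma r] divides. *)
Definition area (n : nat) (r : R) : R := n%:R * omega n * r ^+ n.-1.

Local Notation h1 := (height1 r1 r2 s1 s2).
Local Notation h2 := (height2 r2 s2).
Local Notation phi := (profile r1 r2 s1 s2).
Let u (x : 'rV[R]_n) := phi (enorm x).

Hypothesis cone1 : forall E : set B, measurable E ->
  lebesgue_n (cone r1 E) = (c1%:E * hausdorff n.-1 (E `&` esphere r1))%E.
Hypothesis cone2 : forall E : set B, measurable E ->
  lebesgue_n (cone r2 E) = (c2%:E * hausdorff n.-1 (E `&` esphere r2))%E.
Hypothesis eq1 : s1 ^+ n * (c1 * area n r1) = A1 * h1 `^ p.
Hypothesis eq2 : (s2 ^+ n - s1 ^+ n) * (c2 * area n r2) = A2 * h2 `^ p.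

Let n0 : (0 < n)%N. Proof. exact: leq_trans n2. Qed.
Let r2_gt0 : 0 < r2. Proof. exact: lt_trans r12. Qed.
Let h1_gt0 : 0 < h1. Proof. exact: height1_gt0. Qed.
Let h2_gt0 : 0 < h2. Proof. exact: (height2_gt0 r2_lt1 s1_gt0 s12). Qed.
Let area_gt0 r : 0 < r -> 0 < area n r.
Proof. by move=> r0; rewrite !mulr_gt0 ?omega_gt0 ?exprn_gt0// ltr0n. Qed.

Let phi_r1 : phi r1 = - h1. Proof. exact: profile_inner. Qed.
Let phi_r2 : phi r2 = - h2.
Proof. by rewrite profile_outer// /height2 -mulrN opprB. Qed.

Let measurable_u : measurable_fun setT (u : B -> R).
Proof.
apply: (measurableT_comp (f := phi)); last exact: measurable_enorm.
apply: measurable_maxr => //; apply: measurable_maxr.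
  apply: measurable_funB => //; apply: measurable_funM => //.
  by apply: measurable_funB => //.
by apply: measurable_funM => //; apply: measurable_funB.
Qed.

Let hausdorff0 : @hausdorff R n n.-1 set0 = 0%E.
Proof.
have [|mu muE] := @hausdorff_outer_measure R n n.-1; first by rewrite -ltnS prednK.
by rewrite -muE outer_measure0.
Qed.

Lemma radial_equation : dirichlet_solution p nu u.
Proof.
split=> [E mE E1|x]; last first.
  by rewrite /esphere /= /u => ->; rewrite profile_outer ?subrr ?mulr0// ltW.
rewrite (monge_ampere_radial n0)// cone1// cone2//.
have mS r : measurable (esphere r : set B) by exact: measurable_esphere.
rewrite (@integral_two_spheres _ _ r1 r2 r12 nu _ (h1 `^ p) (h2 `^ p))//; last 4 first.
- apply/measurable_EFinP; apply: (measurableT_comp (measurable_powR p)).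
  by apply: (measurableT_comp (@normr_measurable R setT)).
- rewrite nuE; last by apply: measurableD => //; exact: measurableD.
  rewrite /sigma (_ : _ `&` esphere r1 = set0); last first.
    by apply/seteqP; split=> // x [[[_ nS] _] /nS].
  rewrite (_ : _ `&` esphere r2 = set0); last first.
    by apply/seteqP; split=> // x [[_ nS] /nS].
  by rewrite hausdorff0 !mul0e !mule0 adde0.
- by move=> x; rewrite /esphere /u /= => ->; rewrite phi_r1 normrN gtr0_norm.
- by move=> x; rewrite /esphere /u /= => ->; rewrite phi_r2 normrN gtr0_norm.
have same r (A : set 'rV[R]_n) : sigma r (A `&` esphere r) =
    (hausdorff n.-1 (A `&` esphere r) * ((area n r)^-1)%:E)%E.
  by rewrite /sigma -setIA setIid.
have other r r' (A : set 'rV[R]_n) : r <> r' -> sigma r (A `&` esphere r') = 0%E.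
  move=> rr'; rewrite /sigma (_ : _ `&` _ = set0) ?hausdorff0 ?mul0e//.
  by apply/seteqP; split=> // x [[_ e1] e2]; apply: rr'; rewrite -e1 -e2.
rewrite !nuE; [|exact: measurableI..].
have r12' : r1 <> r2 by apply/eqP; rewrite lt_eqF.
rewrite !same (other r2 r1)//; last exact/nesym.
rewrite (other r1 r2)// !mule0 adde0 add0e.
have key (s c A h r : R) (H : \bar R) : 0 < r -> s * (c * area n r) = A * h ->
    (s%:E * (c%:E * H) = h%:E * (A%:E * (H * ((area n r)^-1)%:E)))%E.
  move=> r0 e; rewrite [(H * _)%E]muleC !muleA -!EFinM; congr (_%:E * _)%E.
  by rewrite [h * A]mulrC -e mulrA mulfK// gt_eqF// area_gt0.
by congr (_ + _)%E; exact: key.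
Qed.

Lemma radial_solution : nonzero_radial_convex_solution p nu u.
Proof.
split.
- exists s2 => x y _ _.
  have h (a b : 'rV[R]_n) : u a - u b <= s2 * enorm (a - b).
    rewrite lerBlDl; apply: le_trans (profile_lipschitz _ _ s1_gt0 s12 _ (enorm b)) _.
    rewrite lerD2l ler_pM2l ?(lt_trans s1_gt0)// ler_norml; apply/andP; split.
      by rewrite lerNl opprB lerBlDr enormC (le_trans _ (ler_enormD _ _))// subrK.
    by rewrite lerBlDr (le_trans _ (ler_enormD _ _))// subrK.
  by rewrite ler_norml h andbT lerNl opprB enormC h.
- move=> t x y _ _.
  have t0 : 0 <= t%:num by []; have t1 : t%:num <= 1 by [].
  apply: (@profile_convex _ r1 r2 s1 s2 s1_gt0 s12 t%:num); first by rewrite t0 t1.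
  change (enorm (t%:num *: (x : 'rV[R]_n) + (1 - t%:num) *: (y : 'rV[R]_n)) <=
    t%:num * enorm x + (1 - t%:num) * enorm y).
  apply: le_trans (ler_enormD _ _) _; rewrite !enormZ ger0_norm// ger0_norm//.
- by move=> x y _ _ xy; rewrite /u xy.
- exact: radial_equation.
- exists 0; first by rewrite /ecball /= enorm0.
  rewrite /u enorm0 profile_inner//; last exact: ltW.
  by apply/eqP; rewrite oppr_eq0 gt_eqF.
Qed.

End radial_solution.

Section distinct.
Context {R : realType} {n : nat}.
Hypothesis n0 : (0 < n)%N.

Lemma exists_enorm (r : R) : 0 <= r -> exists x : 'rV[R]_n, enorm x = r.
Proof.
move=> r0; exists (r *: delta_mx ord0 (Ordinal n0)).
rewrite enormZ ger0_norm// /enorm /dot (bigD1 (Ordinal n0))//= !mxE !eqxx mulr1.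
rewrite big1 ?addr0 ?sqrtr1 ?mulr1// => i /negPf ni.
by rewrite !mxE /= ni mulr0.
Qed.

(** The value at the radius [r2] determines [s2], and then the value at the
    origin determines [s1]. *)
Lemma profile_distinct (r1 r2 s1 s2 s1' s2' : R) : 0 < r1 -> r1 < r2 -> r2 < 1 ->
  0 < s1 -> s1 < s2 -> 0 < s1' -> s1' < s2' -> s1 / s2 <> s1' / s2' ->
  distinct_on (ecball 1 : set 'rV[R]_n) (fun x => profile r1 r2 s1 s2 (enorm x))
    (fun x => profile r1 r2 s1' s2' (enorm x)).
Proof.
move=> r1_gt0 r12 r2_lt1 s1_gt0 s12 s1_gt0' s12' ne.
have [e2|ne2] := pselect (s2 = s2').
  exists 0; first by rewrite /ecball /= enorm0.
  rewrite enorm0 !profile_inner ?ltW// /height1 e2 => /oppr_inj/addrI/mulIf e1.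
  apply: ne; rewrite e2 e1// subr_eq0 gt_eqF//.
have [x xE] := exists_enorm (ltW (lt_trans r1_gt0 r12)).
exists x; first by rewrite /ecball /= xE ltW.
rewrite xE !profile_outer// => /mulIf e2; apply: ne2; apply: e2.
by rewrite subr_eq0 lt_eqF.
Qed.

End distinct.

(** * The equations for the slopes *)

Section scalar_equation.
Context {R : realType}.
Variables (n : nat) (p : R).
Hypotheses (n2 : (2 <= n)%N) (np : n%:R < p).

Let n0 : (0 < n)%N. Proof. exact: leq_trans n2. Qed.
Let p0 : 0 < p. Proof. by apply: lt_trans np; rewrite ltr0n. Qed.
Let pn0 : 0 < p - n%:R. Proof. by rewrite subr_gt0. Qed.

(** The equation for the ratio [t] of the slopes, multiplied by [t ^+ n] to make
    it continuous at 0. *)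
Definition balance (b kappa t : R) := (1 - t ^+ n) * (b + t) `^ p - kappa * t ^+ n.

Lemma balance_ivt b kappa u v : 0 < b -> 0 <= u -> u <= v ->
  balance b kappa u * balance b kappa v < 0 ->
  exists2 t, u < t < v & balance b kappa t = 0.
Proof.
move=> b0 u0 uv uv0.
have cont : {within `[u, v], continuous (balance b kappa)}.
  apply: continuous_in_subspaceT => t; rewrite inE /= in_itv/= => /andP[ut _].
  have bt : 0 < b + t by rewrite ltr_wpDr// (le_trans u0).
  have cX : {for t, continuous (fun t : R => t ^+ n)} by exact: exprn_continuous.
  rewrite /balance; apply: cvgB; last by apply: cvgM; [exact: cvg_cst|exact: cX].
  apply: cvgM; first by apply: cvgB; [exact: cvg_cst|exact: cX].
  have cP : {for b + t, continuous (@powR R ^~ p)}.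
    apply: differentiable_continuous; apply/derivable1_diffP.
    by apply: (@derivable_powR R 1 p (b + t)); rewrite in_itv/= andbT.
  apply: (@continuous_comp _ _ _ (fun t => b + t) (@powR R ^~ p) t) => //.
  by apply: cvgD; [exact: cvg_cst|exact: cvg_id].
have [|t tuv t0] := @IVT R (balance b kappa) u v 0 uv cont.
  rewrite ge_min le_max; case/orP: (le_total 0 (balance b kappa u)) => fu.
    rewrite fu/= andbT; apply/orP; right; rewrite leNgt; apply/negP => fv.
    by move: uv0; rewrite ltNge mulr_ge0// ltW.
  rewrite fu/=; apply/orP; right; rewrite leNgt; apply/negP => fv.
  by move: uv0; rewrite ltNge mulr_le0// ltW.
exists t => //; move: tuv; rewrite in_itv/= => /andP[ut tv].
rewrite !lt_neqAle ut tv !andbT; apply/andP; split; apply/eqP => e.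
  by move: uv0; rewrite e t0 mul0r ltxx.
by move: uv0; rewrite -e t0 mulr0 ltxx.
Qed.

(** [balance b kappa] is positive at 0 and negative at 1; a small [b] makes it
    negative at [b], since [p > n], although it stays positive at 1/2. *)
Lemma balance_three_roots : exists b kappa : R,
  [/\ 0 < b, b < 1 / 2, 0 < kappa &
  exists t1 t2 t3, [/\ 0 < t1, t1 < t2, t2 < t3, t3 < 1 &
   [/\ balance b kappa t1 = 0, balance b kappa t2 = 0 & balance b kappa t3 = 0]]].
Proof.
(* This value is below that of the quotient at 1/2, since [2^-1 ^+ n <= 2^-1],
   whatever [b > 0] is. *)
pose kappa : R := 2^-1 `^ p / 2.
have kappa0 : 0 < kappa by rewrite divr_gt0// powR_gt0 invr_gt0.
(* At [t = b] the quotient is at most [2 `^ p * b `^ (p - n)], which is below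
   [kappa] if [b `^ (p - n) <= x]. *)
pose x := kappa / 2 `^ p / 2.
have x0 : 0 < x by rewrite !divr_gt0// powR_gt0.
pose b := Num.min (1 / 4) (x `^ (p - n%:R)^-1).
have b0 : 0 < b by rewrite lt_min divr_gt0//= powR_gt0.
have b4 : b <= 1 / 4 by rewrite ge_min lexx.
have b2 : b < 1 / 2 by lra.
have bp : b `^ (p - n%:R) <= x.
  apply: le_trans (_ : (x `^ (p - n%:R)^-1) `^ (p - n%:R) <= x).
    by apply: ge0_ler_powR; rewrite ?nnegrE ?ge_min ?lexx ?orbT ?powR_ge0// ltW.
  by rewrite -powRrM mulVf ?gt_eqF// powRr1// ltW.
have f0 : 0 < balance b kappa 0.
  by rewrite /balance expr0n gtn_eqF// mulr0 !subr0 mul1r addr0 powR_gt0.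
have f1 : balance b kappa 1 < 0.
  by rewrite /balance expr1n subrr mul0r sub0r mulr1 oppr_lt0.
have fb : balance b kappa b < 0.
  have bn0 : 0 < b ^+ n by rewrite exprn_gt0.
  rewrite /balance subr_lt0; apply: (@le_lt_trans _ _ ((b + b) `^ p)).
    by rewrite ler_piMl ?powR_ge0// gerBl ltW.
  have -> : b + b = 2 * b by ring.
  rewrite powRM// ?(ltW b0)//.
  have -> : b `^ p = b `^ (p - n%:R) * b ^+ n.
    by rewrite -powR_mulrn ?(ltW b0)// -powRD ?subrK// (gt_eqF b0) implybT.
  rewrite mulrA ltr_pM2r// mulrC -ltr_pdivlMr ?powR_gt0//.
  apply: le_lt_trans bp _; rewrite /x gtr_pMr ?invf_lt1// ?ltr1n//.
  by rewrite divr_gt0// powR_gt0.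
have fh : 0 < balance b kappa 2^-1.
  have h1 : 2^-1 ^+ n <= 2^-1 :> R.
    rewrite -[leRHS]expr1; apply: ler_wiXn2l => //.
    by rewrite invf_le1// ler1n.
  have h0 : 0 < 2^-1 ^+ n :> R by rewrite exprn_gt0// invr_gt0.
  have hp : 2^-1 `^ p <= (b + 2^-1) `^ p.
    apply: ge0_ler_powR;
      rewrite ?nnegrE ?(ltW p0) ?invr_ge0 ?addr_ge0 ?(ltW b0) ?invr_ge0//.
    by rewrite lerDr ltW.
  rewrite /balance subr_gt0.
  apply: (@lt_le_trans _ _ kappa).
    rewrite gtr_pMr//; apply: le_lt_trans h1 _; rewrite invf_lt1// ltr1n//.
  rewrite /kappa mulrC; apply: ler_pM => //; rewrite ?invr_ge0 ?powR_ge0//.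
  by move: h1; set y := (_ ^+ n) => h1; lra.
have [|||t1 /andP[? t1b] e1] := @balance_ivt b kappa 0 b b0 => //.
- exact: ltW.
- by rewrite pmulr_rlt0.
have [|||t2 /andP[bt2 t2h] e2] := @balance_ivt b kappa b 2^-1 b0.
- exact: ltW.
- by rewrite ltW// -[ltRHS]mul1r.
- by rewrite nmulr_rlt0.
have [|||t3 /andP[ht3 t31] e3] := @balance_ivt b kappa 2^-1 1 b0.
- by rewrite invr_ge0.
- by rewrite invf_le1// ler1n.
- by rewrite pmulr_rlt0.
exists b, kappa; split=> //; exists t1, t2, t3; split=> //.
- exact: lt_trans bt2.
- exact: lt_trans ht3.
Qed.

(** [t] is the ratio of the two slopes.  Their size [s] follows from the second
    equation, whose two sides are homogeneous in [s] of the different degrees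
    [n] and [p]. *)
Lemma slopes_of_root b kappa t a1 a2 : 0 < b -> 0 < kappa -> 0 < t -> t < 1 ->
  balance b kappa t = 0 -> exists s : R, let r2 := 1 - b / 2 in let r1 := r2 - 1 / 2 in
  [/\ 0 < s, (t * s) ^+ n * a1 = (a1 * 2 `^ p) * height1 r1 r2 (t * s) s `^ p &
  (s ^+ n - (t * s) ^+ n) * a2 =
    (a2 * 2 `^ p * (kappa / b `^ p)) * height2 r2 s `^ p].
Proof.
move=> b0 kappa0 t0 t1 /eqP; rewrite subr_eq0 => /eqP root.
have tn1 : 0 < 1 - t ^+ n by rewrite subr_gt0 exprn_ilt1 ?(gtn_eqF n0)// ltW.
pose s := ((1 - t ^+ n) / kappa) `^ (p - n%:R)^-1.
have q0 : 0 < (1 - t ^+ n) / kappa by rewrite divr_gt0.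
have s0 : 0 < s by rewrite powR_gt0.
have sp : kappa * s `^ p = (1 - t ^+ n) * s ^+ n.
  have -> : s `^ p = s `^ (p - n%:R) * s ^+ n.
    by rewrite -powR_mulrn ?(ltW s0)// -powRD ?subrK// (gt_eqF s0) implybT.
  rewrite /s -powRrM mulVf ?gt_eqF// powRr1 ?(ltW q0)// -/s.
  by rewrite mulrA mulrCA divff ?gt_eqF// mulr1.
exists s; move=> r2 r1.
have b0' := ltW b0; have t0' := ltW t0; have s0' := ltW s0.
have two_p : 2 `^ p * 2^-1 `^ p = 1 :> R.
  by rewrite -powRM ?invr_ge0// divff// powR1.
have h1E : height1 r1 r2 (t * s) s = s * (b + t) * 2^-1.
  by rewrite /height1 /height2 /r1 /r2; field.
have h2E : height2 r2 s = s * b * 2^-1 by rewrite /height2 /r2; field.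
split=> //.
- rewrite h1E !powRM ?mulr_ge0 ?addr_ge0 ?invr_ge0// exprMn.
  apply: (mulfI (lt0r_neq0 kappa0)).
  rewrite mulrA [kappa * (_ * _)]mulrA -root.
  have -> : kappa * (a1 * 2 `^ p * (s `^ p * (b + t) `^ p * 2^-1 `^ p)) =
    a1 * (2 `^ p * 2^-1 `^ p) * (kappa * s `^ p) * (b + t) `^ p by ring.
  rewrite two_p sp; ring.
- rewrite h2E !powRM ?mulr_ge0 ?invr_ge0// exprMn.
  have bp0 : b `^ p != 0 by rewrite gt_eqF// powR_gt0.
  have -> : a2 * 2 `^ p * (kappa / b `^ p) * (s `^ p * b `^ p * 2^-1 `^ p) =
     a2 * (2 `^ p * 2^-1 `^ p) * (kappa * s `^ p) * (b `^ p / b `^ p) by ring.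
  rewrite two_p sp divff//; ring.
Qed.

End scalar_equation.

(** * The two-sphere measure and its three solutions *)

Lemma finite_measure_of {R : realType} d (T : measurableType d)
    (m : {measure set T -> \bar R}) : (m setT < +oo)%E ->
  exists m' : {finite_measure set T -> \bar R}, m' = m :> (set T -> \bar R).
Proof.
move=> moo.
have f : fin_num_fun m.
  move=> E mE; rewrite ge0_fin_numE//; apply: le_lt_trans moo.
  by apply: le_measure; rewrite ?inE.
pose M1 := isFinite.Build _ _ _ _ f.
have m0 : (m set0 < +oo)%E by rewrite measure0.
have sf := fin_num_fun_sigma_finite m0 f.
pose M2 := isSFinite.Build _ _ _ _ (sfinite_measure_sigma_finite sf).
pose M3 := isSigmaFinite.Build _ _ _ _ sf.
by exists (HB.pack_for (FiniteMeasure.type T R) (Measure.sort m) M1 M2 M3).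
Qed.

Lemma two_sphere_measure {R : realType} n (r1 r2 A1 A2 : R) : (2 <= n)%N ->
  0 < r1 -> 0 < r2 -> 0 < A1 -> 0 < A2 ->
  exists nu : {finite_measure set (borel R n) -> \bar R},
    forall E : set (borel R n), measurable E ->
      nu E = (A1%:E * sigma r1 E + A2%:E * sigma r2 E)%E.
Proof.
move=> n2 r1_gt0 r2_gt0 A1_gt0 A2_gt0.
have n0 : (0 < n)%N by exact: leq_trans n2.
have m0 : (0 < n.-1)%N by rewrite -ltnS prednK.
have [H HE] := @hausdorff_borel_measure R n n.-1 m0.
have sphere r A : 0 < r -> 0 < A -> exists m : {measure set (borel R n) -> \bar R},
    (m setT < +oo)%E /\ forall E, m E = (A%:E * sigma r E)%E.
  move=> r0 A0.
  have [m mE] := restricted_measure H (@measurable_esphere R n r).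
  have w0 : 0 <= A * (n%:R * omega n * r ^+ n.-1)^-1.
    by rewrite mulr_ge0 ?invr_ge0 ?mulr_ge0 ?exprn_ge0 ?(ltW (omega_gt0 _)) ?(ltW r0) ?(ltW A0).
  exists (mscale (NngNum w0) m); split.
    rewrite /= /mscale /= mE HE setTI lte_mul_pinfty ?lee_fin//.
    exact: hausdorff_sphere_lty.
  move=> E; rewrite /= /mscale /= mE HE /sigma EFinM -muleA; congr (_ * _)%E.
  by rewrite muleC.
have [m1 [m1oo m1E]] := sphere r1 A1 r1_gt0 A1_gt0.
have [m2 [m2oo m2E]] := sphere r2 A2 r2_gt0 A2_gt0.
have [|nu nuE] := @finite_measure_of R _ (borel R n) (measure_add m1 m2).
  apply: (@le_lt_trans _ _ (m1 setT + m2 setT)%E); last exact: lte_add_pinfty.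
  by rewrite le_eqVlt; apply/orP; left; apply/eqP; exact: measure_addE.
exists nu => E _; rewrite nuE; transitivity (m1 E + m2 E)%E; first exact: measure_addE.
by rewrite m1E m2E.
Qed.

Theorem theorem1p3 (R : realType) (n : nat) (p : R)
    (hn : (2 <= n)%N) (hp : n%:R < p) :
  exists r1 r2 A1 A2 : R,
    [/\ 0 < r1, r1 < r2, r2 < 1, 0 < A1 & 0 < A2] /\
    exists nu : {finite_measure set (borel R n) -> \bar R},
      (forall E : set (borel R n), measurable E ->
         nu E = (A1%:E * sigma r1 E + A2%:E * sigma r2 E)%E) /\
      exists u1 u2 u3 : 'rV[R]_n -> R,
        [/\ nonzero_radial_convex_solution p nu u1,
            nonzero_radial_convex_solution p nu u2 &
            nonzero_radial_convex_solution p nu u3] /\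
        [/\ distinct_on (ecball 1) u1 u2,
            distinct_on (ecball 1) u1 u3 &
            distinct_on (ecball 1) u2 u3].
Proof.
have n0 : (0 < n)%N by exact: leq_trans hn.
have [b [kappa [b0 b2 kappa0 [t1 [t2 [t3 [t1_gt0 t12 t23 t3_lt1 [e1 e2 e3]]]]]]]] :=
  balance_three_roots hn hp.
pose r2 : R := 1 - b / 2; pose r1 : R := r2 - 1 / 2.
have r1_gt0 : 0 < r1 by rewrite /r1 /r2; lra.
have r12 : r1 < r2 by rewrite /r1 /r2; lra.
have r2_lt1 : r2 < 1 by rewrite /r2; lra.
have r2_gt0 := lt_trans r1_gt0 r12.
have [c1 c1_gt0 cone1] := cone_volume_hausdorff hn r1_gt0.
have [c2 c2_gt0 cone2] := cone_volume_hausdorff hn r2_gt0.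
have area_gt0 r : 0 < r -> 0 < area n r :> R.
  by move=> r0; rewrite !mulr_gt0 ?omega_gt0 ?exprn_gt0// ltr0n.
pose a1 := c1 * area n r1; have a1_gt0 : 0 < a1 by rewrite mulr_gt0// area_gt0.
pose a2 := c2 * area n r2; have a2_gt0 : 0 < a2 by rewrite mulr_gt0// area_gt0.
pose A1 := a1 * 2 `^ p; have A1_gt0 : 0 < A1 by rewrite mulr_gt0// powR_gt0.
pose A2 := a2 * 2 `^ p * (kappa / b `^ p).
have A2_gt0 : 0 < A2.
  apply: mulr_gt0; last by rewrite divr_gt0// powR_gt0.
  by apply: mulr_gt0 => //; rewrite powR_gt0.
have [nu nuE] := two_sphere_measure hn r1_gt0 r2_gt0 A1_gt0 A2_gt0.
exists r1, r2, A1, A2; split=> //; exists nu; split=> //.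
have sol t : 0 < t -> t < 1 -> balance n p b kappa t = 0 ->
    exists s, [/\ 0 < s, 0 < t * s, t * s < s &
      nonzero_radial_convex_solution p nu
        (fun x => profile r1 r2 (t * s) s (enorm x))].
  move=> t_gt0 t_lt1 et.
  have [s /= [s_gt0 q1 q2]] := slopes_of_root hn hp a1 a2 b0 kappa0 t_gt0 t_lt1 et.
  exists s; have ts : t * s < s by rewrite gtr_pMl.
  split=> //; first by rewrite mulr_gt0.
  apply: (@radial_solution _ _ hn r1 r2 (t * s) s p r1_gt0 r12 r2_lt1 _ ts A1 A2 c1 c2) => //.
  by rewrite mulr_gt0.
have t2_gt0 := lt_trans t1_gt0 t12; have t3_gt0 := lt_trans t2_gt0 t23.
have t2_lt1 := lt_trans t23 t3_lt1; have t1_lt1 := lt_trans t12 t2_lt1.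
have [s1 [s1_gt0 p1 q1 sol1]] := sol t1 t1_gt0 t1_lt1 e1.
have [s2 [s2_gt0 p2 q2 sol2]] := sol t2 t2_gt0 t2_lt1 e2.
have [s3 [s3_gt0 p3 q3 sol3]] := sol t3 t3_gt0 t3_lt1 e3.
exists (fun x => profile r1 r2 (t1 * s1) s1 (enorm x)),
  (fun x => profile r1 r2 (t2 * s2) s2 (enorm x)),
  (fun x => profile r1 r2 (t3 * s3) s3 (enorm x)).
split; first by split.
have dist t s t' s' : 0 < s -> 0 < s' -> 0 < t * s -> t * s < s -> 0 < t' * s' ->
  t' * s' < s' -> t < t' ->
  distinct_on (ecball 1 : set 'rV[R]_n) (fun x => profile r1 r2 (t * s) s (enorm x))
    (fun x => profile r1 r2 (t' * s') s' (enorm x)).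
  move=> s0 s'0 ts0 ts ts'0 ts' tt'; apply: profile_distinct => //.
  by rewrite !mulfK ?gt_eqF//; apply/eqP; rewrite lt_eqF.
by split; apply: dist => //; exact: lt_trans t23.
Qed.
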